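(* Let $k,n$ be integers with $2\le k\le n-2$. Then the Ehrhart polynomial $i(\mathrm{Sp}_{k,n},t)$ has positive coefficients, and coefficient-wise $$i(T_{k,n},t)\le i(\mathrm{Sp}_{k,n},t)\le i(U_{k,n},t),$$ i.e. for every $m\ge0$ the coefficient of $t^m$ in $i(\mathrm{Sp}_{k,n},t)$ lies between the coefficients of $t^m$ in $i(T_{k,n},t)$ and in $i(U_{k,n},t)$.
   Context: For $S,T\subseteq[n]$, write $T\le S$ if $|T|=|S|$ and the $i$-th smallest element of $T$ is at most the $i$-th smallest element of $S$ for each $i$. The Schubert matroid $\mathrm{SM}_n(S)$ is the matroid on $[n]$ with bases $\{T\subseteq[n]:T\le S\}$. For a matroid $M$ on $[n]$, $i(M,t)$ is the Ehrhart polynomial of its matroid polytope $\mathrm{conv}\{\sum_{b\in B}e_b: B \text{ a basis}\}$ (number of lattice points in the $t$-th dilate). $U_{k,n}=\mathrm{SM}_n(\{n-k+1,\dots,n\})$ is the uniform matroid; $T_{k,n}=\mathrm{SM}_n(\{2,3,\dots,k,n\})$ is the minimal matroid; $\mathrm{Sp}_{k,n}=\mathrm{SM}_n(\{k\}\cup\{k+2,k+3,\dots,n\})$ (indicator vector $(0^{k-1},1,0,1^{n-k-1})$). *)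

(* Defs.v *)
From HB Require Import structures.
From mathcomp Require Import all_boot all_order all_algebra.
From mathcomp Require Import boolp.

Set Implicit Arguments.
Unset Strict Implicit.
Unset Printing Implicit Defensive.

Import Order.TTheory GRing.Theory Num.Theory.

(* Ground set [n] is modelled by 'I_n = {0,...,n-1} (element i+1 of [n] is i). *)

Definition sorted_elems (n : nat) (S : {set 'I_n}) : seq nat :=
  sort leq [seq val x | x <- enum S].

Definition gale_le (n : nat) (T S : {set 'I_n}) : bool :=
  (#|T| == #|S|) &&
  [forall i : 'I_n, (i < #|T|) ==>
     (nth 0 (sorted_elems T) i <= nth 0 (sorted_elems S) i)].

Definition schubert_bases (n : nat) (S : {set 'I_n}) : {set {set 'I_n}} :=
  [set T : {set 'I_n} | gale_le T S].

Definition in_dilate (n : nat) (Bs : {set {set 'I_n}}) (t : nat)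
    (x : 'I_n -> nat) : Prop :=
  exists lam : {ffun {set 'I_n} -> rat},
    [/\ (forall B, 0 <= lam B)%R,
        (forall B, B \notin Bs -> lam B = 0%R),
        (\sum_(B : {set 'I_n}) lam B = t%:R)%R &
        (forall i : 'I_n,
            (x i)%:R = \sum_(B : {set 'I_n}) lam B * (i \in B)%:R)%R].

(* Number of lattice points of the t-th dilate.  Every lattice point of tP
   has coordinates in {0,...,t} (P lies in [0,1]^n), so we count over
   the finite type of functions 'I_n -> 'I_t.+1. *)
Definition ehrhart_count (n : nat) (Bs : {set {set 'I_n}}) (t : nat) : nat :=
  #|[set x : {ffun 'I_n -> 'I_t.+1} |
      `[< in_dilate Bs t (fun i => nat_of_ord (x i)) >] ]|.

Definition is_ehrhart_poly (n : nat) (Bs : {set {set 'I_n}}) (p : {poly rat})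
  : Prop :=
  forall t : nat, p.[t%:R]%R = (ehrhart_count Bs t)%:R%R.

(* U_{k,n} = SM_n({n-k+1,...,n}) *)
Definition U_set (k n : nat) : {set 'I_n} := [set i : 'I_n | n - k <= i].
(* T_{k,n} = SM_n({2,...,k,n}) *)
Definition T_set (k n : nat) : {set 'I_n} :=
  [set i : 'I_n | (1 <= i < k) || (i == n.-1 :> nat)].
(* Sp_{k,n} = SM_n({k} u {k+2,...,n}) *)
Definition Sp_set (k n : nat) : {set 'I_n} :=
  [set i : 'I_n | (i == k.-1 :> nat) || (k.+1 <= i)].

(* Main.v *)
(** Complementing coordinates shows that the three lattice point counts are
    the sums over s of C(s+k-1,k-1) C(s+n-k-1,n-k-1), truncated to the box:
    T takes s <= t, Sp takes s >= t and U takes all s.  Hence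
    i(Sp,t) = i(U,t) - i(T,t-1), and what has to be proved is
    i(T,t) + i(T,t-1) <= i(U,t) coefficientwise.

    Put Q = 1/((1-z)(1-xz)), L = sum_j (1+x+...+x^(j-1)) z^j/j,
    Lam = sum_j (1+x^j) z^j/j, R = Lam/(1+x-xz), and let A_m be the Eulerian
    polynomials.  Up to the common factor 1/m!, the coefficients of t^m (m > 0) in
    i(U,t), i(T,t) and i(T,t-1) are the coefficients of x^(k-1) z^(n-1) in
    A_m Q L^m, Q R Lam^(m-1) and R Lam^(m-1).  Now R <= L and Lam <= (1+x) L
    coefficientwise, and the Eulerian numbers dominate the binomial coefficients;
    together with the decompositions L = a + M and x L = b + M, where
    a = -log(1-z) and b = -log(1-xz), this gives
    A_m L^m + a^m + b^m/x >= 2 R Lam^(m-1) by induction on m, and the terms a^m and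
    b^m/x do not contribute when 2 <= k <= n-2. *)
Require Import Defs.
From HB Require Import structures.
From mathcomp Require Import all_boot all_order all_algebra.
From mathcomp Require Import boolp.
From mathcomp Require Import zify ring lra.
Import Order.TTheory GRing.Theory Num.Theory.

Set Implicit Arguments.
Unset Strict Implicit.
Unset Printing Implicit Defensive.

Local Open Scope ring_scope.

(** * Truncated power series *)

Section EqTrunc.
Context {R : nzRingType}.
Implicit Types p q r s : {poly R}.

(** Congruence modulo a power of the variable, so that polynomials can stand in for power series. *)
Definition eqtr (N : nat) p q := forall i, (i < N)%N -> p`_i = q`_i.

Lemma eqtr_refl N p : eqtr N p p. Proof. by []. Qed.

Lemma eqtr_eq N p q : p = q -> eqtr N p q.
Proof. by move=> ->. Qed.

Lemma eqtr_sym N p q : eqtr N p q -> eqtr N q p.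
Proof. by move=> h i iN; rewrite h. Qed.

Lemma eqtr_trans N q p r : eqtr N p q -> eqtr N q r -> eqtr N p r.
Proof. by move=> h g i iN; rewrite h ?g. Qed.

Lemma eqtrW N M p q : (M <= N)%N -> eqtr N p q -> eqtr M p q.
Proof. by move=> MN h i iM; apply: h; apply: leq_trans MN. Qed.

Lemma eqtrD N p q r s : eqtr N p q -> eqtr N r s -> eqtr N (p + r) (q + s).
Proof. by move=> h g i iN; rewrite !coefD h ?g. Qed.

Lemma eqtrN N p q : eqtr N p q -> eqtr N (- p) (- q).
Proof. by move=> h i iN; rewrite !coefN h. Qed.

Lemma eqtrB N p q r s : eqtr N p q -> eqtr N r s -> eqtr N (p - r) (q - s).
Proof. by move=> h g; apply: eqtrD => //; apply: eqtrN. Qed.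

Lemma eqtrM N p q r s : eqtr N p q -> eqtr N r s -> eqtr N (p * r) (q * s).
Proof.
move=> h g i iN; rewrite !coefM; apply: eq_bigr => j _.
by rewrite h ?g //; have := ltn_ord j; lia.
Qed.

Lemma eqtrX N m p q : eqtr N p q -> eqtr N (p ^+ m) (q ^+ m).
Proof. by move=> h; elim: m => // m IH; rewrite !exprS; apply: eqtrM. Qed.

Lemma eqtr_deriv N p q : eqtr N p q -> eqtr N.-1 p^`() q^`().
Proof. by move=> h i iN; rewrite !coef_deriv h //; lia. Qed.

Lemma eqtr_mulX N p q : eqtr N.-1 p q -> eqtr N ('X * p) ('X * q).
Proof. by move=> h [|i] iN; rewrite !coefXM //= h //; lia. Qed.

End EqTrunc.
Arguments eqtr_refl {R} N p.
Arguments eqtr_trans {R N} q {p r}.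

Lemma coefXn_lt0 (R : nzRingType) (p : {poly R}) m i :
  p`_0 = 0 -> (i < m)%N -> (p ^+ m)`_i = 0.
Proof.
move=> p0; elim: m i => // m IH i im; rewrite exprS coefM big1 // => j _.
case: j => [[|j] /= jl]; first by rewrite p0 mul0r.
by rewrite IH ?mulr0 //; lia.
Qed.

(** The constant coefficient of [c] need not be a unit; comparing coefficients in increasing order,
    each new one only has to be cancelled in a domain. *)
Lemma eqtr_cancel (R : idomainType) N (c p q : {poly R}) :
  c`_0 != 0 -> eqtr N (c * p) (c * q) -> eqtr N p q.
Proof.
move=> c0 h; elim/ltn_ind => i IH iN.
have := h i iN; rewrite !coefM !big_ord_recl /= subn0.
rewrite [X in _ + X = _](_ : _ = \sum_(j < i) c`_(bump 0 j) * q`_(i - bump 0 j)).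
  by move/addIr/(mulfI c0).
apply: eq_bigr => j _; rewrite IH //; rewrite /bump /=; have := ltn_ord j; lia.
Qed.

Section Exp.
Local Notation K := {poly rat}.
Implicit Types P W f g c : {poly K}.

Definition ratCC (r : rat) : {poly K} := r%:P%:P.

(** The exponential of y P modulo z^N; for P without constant term the omitted powers vanish
    there. *)
Definition expz (N : nat) P (y : rat) : {poly K} :=
  \sum_(m < N) ratCC (y ^+ m / m`!%:R) * P ^+ m.

Lemma ratCCM r s : ratCC (r * s) = ratCC r * ratCC s.
Proof. by rewrite /ratCC !polyCM. Qed.

Lemma ratCC_nat n : ratCC n%:R = n%:R.
Proof. by rewrite /ratCC !rmorph_nat. Qed.

Lemma ratCC_deriv r : (ratCC r)^`() = 0.
Proof. by rewrite /ratCC derivC. Qed.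

(** The equation f' = c f determines each coefficient from the earlier ones, because i + 1 can be
    cancelled over the rationals. *)
Lemma eqtr_ode N c f g : f`_0 = g`_0 ->
  eqtr N.-1 f^`() (c * f) -> eqtr N.-1 g^`() (c * g) -> eqtr N f g.
Proof.
move=> h0 hf hg; elim/ltn_ind => -[|i] IH iN //.
have iN' : (i < N.-1)%N by lia.
have := hf i iN'; have := hg i iN'; rewrite !coef_deriv !coefM => eg ef.
have e : f`_i.+1 *+ i.+1 = g`_i.+1 *+ i.+1.
  rewrite ef eg; apply: eq_bigr => j _; rewrite IH //; have := ltn_ord j; lia.
apply/polyP => l; have /polyP/(_ l) := e; rewrite !coefMn.
by move/eqP; rewrite -subr_eq0 -mulrnBl mulrn_eq0 /= subr_eq0 => /eqP.
Qed.

Lemma expz_deriv N P y : P`_0 = 0 ->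
  eqtr N.-1 (expz N P y)^`() (ratCC y * P^`() * expz N P y).
Proof.
move=> P0; case: N => [|N] //=.
rewrite /expz raddf_sum /= big_ord_recl /= expr0 mulr1 ratCC_deriv add0r.
have -> : \sum_(i < N) (ratCC (y ^+ (bump 0 i) / (bump 0 i)`!%:R) * P ^+ bump 0 i)^`()
   = ratCC y * P^`() * \sum_(m < N) ratCC (y ^+ m / m`!%:R) * P ^+ m.
  rewrite big_distrr /=; apply: eq_bigr => i _.
  rewrite derivM ratCC_deriv mul0r add0r deriv_exp /bump /= add1n /=.
  rewrite -[X in _ * X]mulr_natr -[i.+1%:R in LHS]ratCC_nat.
  have -> : ratCC (y ^+ i.+1 / i.+1`!%:R) =
            ratCC y * ratCC (y ^+ i / i`!%:R) * ratCC (i.+1%:R^-1).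
    rewrite -!ratCCM exprS factS natrM invfM; congr ratCC; ring.
  have e : ratCC i.+1%:R * ratCC (i.+1%:R^-1) = 1.
    by rewrite -ratCCM mulfV ?pnatr_eq0.
  transitivity (ratCC y * P^`() * (ratCC (y ^+ i / i`!%:R) * P ^+ i)
      * (ratCC i.+1%:R * ratCC i.+1%:R^-1)); first by ring.
  by rewrite e mulr1.
(* The differentiated sum stops one term short of [expz]; the missing multiple of [P ^+ N] vanishes
   modulo z^N. *)
rewrite big_ord_recr /= mulrDr -[X in eqtr _ X _]addr0.
apply: eqtrD => // i iN; rewrite coef0 mulrA coefM big1 // => j _.
by rewrite [(P ^+ N)`__]coefXn_lt0 ?mulr0 //; have := ltn_ord j; lia.
Qed.

(** Both W^y and exp(y P) solve f' = y P' f with constant term 1. *)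
Lemma eqtr_expz N P W (y : nat) : P`_0 = 0 -> W`_0 = 1 ->
  eqtr N.-1 W^`() (P^`() * W) -> eqtr N (W ^+ y) (expz N P y%:R).
Proof.
case: N => [|N] P0 W0 dW //.
apply: (@eqtr_ode _ (ratCC y%:R * P^`())); last exact: expz_deriv.
  have -> : (W ^+ y)`_0 = 1 by elim: y => [|y IH];
    rewrite ?expr0 ?coef1 // exprS coefM big_ord1 W0 IH mulr1.
  rewrite /expz coef_sum big_ord_recl big1 => [|i _].
    by rewrite /= !expr0 mulr1 divr1 /ratCC coefC addr0.
  by rewrite /ratCC coefCM coefXn_lt0 ?mulr0.
case: y => [|y]; first by rewrite expr0 derivC ratCC_nat mul0r mul0r.
rewrite deriv_exp /= ratCC_nat exprS -mulr_natl.
have -> : y.+1%:R * P^`() * (W * W ^+ y) = y.+1%:R * (P^`() * W * W ^+ y) by ring.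
by apply: eqtrM => //; apply: eqtrM.
Qed.

End Exp.

(** * Coefficientwise inequalities *)

Section Nonneg.
Local Notation K := {poly rat}.
Implicit Types P S : {poly K}.

(** Domination of [S] by [P], jointly in x and z, is expressed as [nng (P - S)]. *)
Definition nng P := forall i j, 0 <= P`_i`_j.

Lemma nngD P S : nng P -> nng S -> nng (P + S).
Proof. by move=> h g i j; rewrite !coefD addr_ge0. Qed.

Lemma nngM P S : nng P -> nng S -> nng (P * S).
Proof.
move=> h g i j; rewrite coefM coef_sum; apply: sumr_ge0 => l _.
by rewrite coefM; apply: sumr_ge0 => u _; rewrite mulr_ge0.
Qed.

Lemma nng1 : nng 1.
Proof. by move=> i j; rewrite coef1; case: eqP => _; rewrite ?coef1 ?coef0 ?ler0n. Qed.

Lemma nngX P m : nng P -> nng (P ^+ m).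
Proof. by move=> h; elim: m => [|m IH]; rewrite ?expr0 ?exprS; [exact: nng1|exact: nngM]. Qed.

Lemma nngC (p : K) : (forall j, 0 <= p`_j) -> nng p%:P.
Proof. by move=> h i j; rewrite coefC; case: eqP => _ //; rewrite coef0. Qed.

Lemma nng2 P : nng P -> nng (2%:R * P).
Proof. by move=> h; rewrite mulr_natl mulr2n; apply: nngD. Qed.

Lemma nng_exp_sub P S m : nng S -> nng (P - S) -> nng (P ^+ m - S ^+ m).
Proof.
move=> hS hPS; have hP : nng P by rewrite -(subrK S P); apply: nngD.
elim: m => [|m IH]; first by rewrite !expr0 subrr => i j; rewrite !coef0.
have -> : P ^+ m.+1 - S ^+ m.+1 = P * (P ^+ m - S ^+ m) + (P - S) * S ^+ m.
  by rewrite !exprS; ring.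
by apply: nngD; apply: nngM => //; apply: nngX.
Qed.

Lemma nng_mul_sub P S P' S' : nng P -> nng S' ->
  nng (P - S) -> nng (P' - S') -> nng (P * P' - S * S').
Proof.
move=> hP hS' h h'.
have -> : P * P' - S * S' = P * (P' - S') + (P - S) * S' by ring.
by apply: nngD; apply: nngM.
Qed.

End Nonneg.

(** * Eulerian polynomials and lower bounds for their coefficients *)

Section Eulerian.
Local Notation K := {poly rat}.

(** Normalised without an extra factor x: A_0 = A_1 = 1, and A_m has degree m - 1 for m > 0. *)
Fixpoint eulerian (m : nat) : K :=
  if m is m'.+1 then
    (1 + m'%:R *: 'X) * eulerian m' + ('X - 'X^2) * (eulerian m')^`()
  else 1.

Lemma eulerian1 : eulerian 1 = 1.
Proof. by rewrite /= derivC scale0r addr0 mulr1 mulr0 addr0. Qed.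

Lemma eulerian2 : eulerian 2 = 1 + 'X.
Proof.
have -> : eulerian 2 =
    (1 + 1%:R *: 'X) * eulerian 1 + ('X - 'X^2) * (eulerian 1)^`() by [].
by rewrite eulerian1 derivC mulr0 addr0 mulr1 scale1r.
Qed.

Lemma coef_eulerianS0 m : (eulerian m.+1)`_0 = (eulerian m)`_0.
Proof.
rewrite /= coefD !coefM !big_ord1 !subnn !coefD !coefN coefZ coefX coefXn coef1 /=.
by rewrite mulr0 addr0 mul1r subr0 mul0r addr0.
Qed.

Lemma coef_eulerianS m i : (eulerian m.+1)`_i.+1 =
  i.+2%:R * (eulerian m)`_i.+1 + (m%:R - i%:R) * (eulerian m)`_i.
Proof.
rewrite /= mulrDl mul1r -scalerAl mulrBl expr2 -mulrA.
rewrite !coefD coefN coefZ !coefXM /= !coef_deriv.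
case: i => [|i] /=.
  by rewrite mulr1n; ring.
rewrite -(mulr_natl (eulerian m)`_i.+2 i.+2) -(mulr_natl (eulerian m)`_i.+1 i.+1).
have e q : q.+1%:R = q%:R + 1 :> rat by rewrite -addn1 natrD.
rewrite !e; ring.
Qed.

Lemma eulerian_eq0 m i : (m <= i)%N -> (0 < i)%N -> (eulerian m)`_i = 0.
Proof.
elim: m i => [|m IH] [|i] // mi _; first by rewrite coef1.
rewrite coef_eulerianS IH ?mulr0 ?add0r; try lia.
have [->|mi'] := eqVneq m i; first by rewrite subrr mul0r.
by rewrite IH ?mulr0 //; lia.
Qed.

Lemma eulerian_ge1 m i : (i < m)%N -> 1 <= (eulerian m)`_i.
Proof.
elim: m i => [|m IH] [|i] // im.
  rewrite coef_eulerianS0; case: m IH {im} => [|m] IH; first by rewrite coef1.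
  exact: IH.
rewrite coef_eulerianS.
have h := IH i im.
have h' : 0 <= (eulerian m)`_i.+1.
  have [im'|im'] := ltnP i.+1 m; first exact: le_trans (IH _ im').
  by rewrite eulerian_eq0.
have h2 : 1 <= m%:R - i%:R :> rat.
  by rewrite lerBrDr nat1r ler_nat; lia.
have : 0 <= i.+2%:R * (eulerian m)`_i.+1 by rewrite mulr_ge0.
nra.
Qed.

Lemma eulerian_ge0 m i : 0 <= (eulerian m)`_i.
Proof.
have [im|im] := ltnP i m; first by apply: le_trans (eulerian_ge1 im).
case: i im => [|i] im; last by rewrite eulerian_eq0.
by case: m im => // _; rewrite coef1.
Qed.

Lemma coef_1DX_mul (p : K) j : ((1 + 'X) * p)`_j = p`_j + (if j == 0 then 0 else p`_j.-1).
Proof. by rewrite mulrDl mul1r coefD coefXM. Qed.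

Lemma eulerianS_ge m j : (0 < m)%N ->
  0 <= (eulerian m.+1 - (1 + 'X) * eulerian m)`_j.
Proof.
move=> m0; rewrite coefB coef_1DX_mul.
case: j => [|i] /=; first by rewrite coef_eulerianS0 addr0 subrr.
have [im|im] := ltnP i m; last first.
  by rewrite coef_eulerianS !eulerian_eq0 ?mulr0 ?add0r ?subrr; try lia.
have h2 : 1 <= m%:R - i%:R :> rat.
  by rewrite lerBrDr nat1r ler_nat; lia.
have h3 : 1 <= i.+2%:R :> rat by rewrite ler1n.
rewrite coef_eulerianS; have := eulerian_ge0 m i; have := eulerian_ge0 m i.+1.
nra.
Qed.

(** For 0 < j < m the surplus over (1 + x) A_m is j A_m[j] + (m - j) A_m[j-1] >= m >= 2. This pays
    for both monomials, even at m = 2 where they coincide. *)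
Lemma eulerianS_gt m j : (1 < m)%N ->
  0 <= (eulerian m.+1 - (1 + 'X) * eulerian m - 'X - 'X^(m.-1))`_j.
Proof.
move=> m1; rewrite 2!coefB coefX coefXn.
have [/andP[j0 jm]|jb] := boolP (0 < j < m)%N; last first.
  have -> : (j == 1)%N = false by lia.
  have -> : (j == m.-1)%N = false by lia.
  by rewrite !subr0 eulerianS_ge //; lia.
case: j j0 jm => [//|i] _ im.
rewrite coefB coef_1DX_mul /= coef_eulerianS.
have h1 : 1 <= (eulerian m)`_i.+1 by apply: eulerian_ge1.
have h2 : 1 <= (eulerian m)`_i by apply: eulerian_ge1; lia.
have h3 : (i.+1 == 1)%:R + (i.+1 == m.-1)%:R <= 2%:R :> rat.
  by do 2 case: eqP => _.
have h4 : i%:R + 2%:R <= m%:R :> rat by rewrite -natrD ler_nat; lia.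
have h5 : 0 <= i%:R :> rat by [].
have -> : i.+2%:R = i%:R + 2%:R :> rat by rewrite -natrD addn2.
nra.
Qed.

(* Worpitzky's identity as power series: sum_(i>=1) i^m x^i = x A_m(x) / (1-x)^(m+1) *)
Lemma eulerian_series N m :
  eqtr N ((\poly_(i < N) (if i == 0 then 0 else (i%:R ^+ m : rat))) * (1 - 'X) ^+ m.+1)
         ('X * eulerian m).
Proof.
elim: m => [|m IH].
  rewrite expr1 mulr1 => -[|i] iN; rewrite mulrBr mulr1 coefB coefMX coefX coef_poly iN /=.
    by rewrite subrr.
  rewrite coef_poly (ltn_trans _ iN) //; case: i iN => [|i] iN /=; by rewrite ?subr0 ?expr0 ?subrr.
set S := (X in X * _).
pose S0 : K := \poly_(i < N) (if i == 0 then 0 else (i%:R ^+ m : rat)).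
(* The operator x d/dx multiplies the i-th coefficient by i, so the next case follows by
   differentiating the induction hypothesis. *)
have eS : S = 'X * S0^`().
  apply/polyP => -[|i]; rewrite coefXM coef_poly /=; first by case: ifP.
  rewrite coef_deriv coef_poly; case: ifP => _; last by rewrite mul0rn.
  by rewrite exprSr mulr_natr.
have := eqtr_mulX (eqtr_deriv IH); rewrite -/S0 => /(eqtrM (eqtr_refl N (1 - 'X))).
set A := eulerian m; rewrite !derivM derivX deriv_exp derivB derivX derivC /= => H.
apply: (eqtr_trans ((1 - 'X) * ('X * (1 * A + 'X * A^`())) + m.+1%:R * 'X * (S0 * (1 - 'X)^+m.+1))).
  have -> : S * (1 - 'X) ^+ m.+2 =
    ((1 - 'X) * ('X * (S0^`() * (1 - 'X) ^+ m.+1 + S0 * ((0 - 1) * (1 - 'X) ^+ m *+ m.+1))))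
     + m.+1%:R * 'X * (S0 * (1 - 'X)^+m.+1).
    by rewrite eS -mulr_natl !exprS; ring.
  exact: eqtrD.
apply: (eqtr_trans ((1 - 'X) * ('X * (1 * A + 'X * A^`())) + m.+1%:R * 'X * ('X * A))).
  by apply: eqtrD => //; apply: eqtrM.
rewrite -/A scaler_nat -mulr_natl -natr1.
set B := A^`().
by apply: eqtr_eq; ring.
Qed.

End Eulerian.

Lemma polyC_sub_1DX_mul (p q : {poly rat}) :
  (p - (1 + 'X) * q)%:P = p%:P - (1 + 'X%:P) * q%:P.
Proof. by rewrite polyCB polyCM polyCD polyC1. Qed.

(** * The main coefficientwise inequality, for abstract series *)

Section MainInequality.
Local Notation K := {poly rat}.
Local Notation eulz m := (eulerian m)%:P.
Local Notation x := ('X%:P : {poly K}).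
(** [be] stands for b/x, and [M] for the common remainder L - a = x L - b. *)
Variables a be M Rr : {poly K}.
Let L := a + M.
Let Lam := a + x * be.
Hypothesis xL : x * L = x * be + M.
Hypotheses (a0 : nng a) (be0 : nng be) (M0 : nng M).
Hypothesis (Lbe : nng (L - be)) (LR : nng (L - Rr)) (LR2 : nng (L + a + be - 2%:R * Rr)).

Let x0 : nng x.
Proof. by apply: nngC => j; rewrite coefX; case: eqP. Qed.

Let L0 : nng L. Proof. exact: nngD. Qed.
Let La : nng (L - a). Proof. by rewrite /L addrC addKr. Qed.
Let Lam0 : nng Lam. Proof. by apply: nngD => //; apply: nngM. Qed.

Let ML : M = x * L - x * be. Proof. by rewrite xL addrC addKr. Qed.
Let eL : (1 + x) * L = Lam + 2%:R * M.
Proof. by rewrite mulrDl mul1r xL /L /Lam; ring. Qed.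

(** Each induction step multiplies by (1 + x) L = Lam + 2 M, which dominates [Lam], and uses A_(m+2)
    >= (1 + x) A_(m+1). *)
Lemma euler_log_ge m : nng (eulz m.+1 * L ^+ m.+1 - L * Lam ^+ m).
Proof.
elim: m => [|m IH].
  rewrite eulerian1.
  rewrite mul1r mulr1 subrr => i j; by rewrite !coef0.
have -> : eulz m.+2 * L ^+ m.+2 - L * Lam ^+ m.+1 =
   (eulerian m.+2 - (1 + 'X) * eulerian m.+1)%:P * L ^+ m.+2
   + (1 + x) * L * (eulz m.+1 * L ^+ m.+1 - L * Lam ^+ m)
   + L * (2%:R * M) * Lam ^+ m.
  have -> : 2%:R * M = (1 + x) * L - Lam by rewrite eL; ring.
  rewrite polyC_sub_1DX_mul.
  by move: (eulz m.+2) (eulz m.+1) => A' A; rewrite !exprS; ring.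
apply: nngD; first apply: nngD.
- by apply: nngM; [apply: nngC => j; apply: eulerianS_ge|apply: nngX].
- by apply: nngM => //; rewrite eL; apply: nngD => //; apply: nng2.
- by apply: nngM; [apply: nngM => //; apply: nng2|apply: nngX].
Qed.

(** The base case is M (L - a) + M (L - be) >= 0; the induction again multiplies by (1 + x) L. *)
Lemma euler_log_ge2 m : nng (eulz m.+2 * L ^+ m.+2
   + a ^+ m.+2 + x ^+ m.+1 * be ^+ m.+2 - 2%:R * (L * Lam ^+ m.+1)).
Proof.
elim: m => [|m IH].
  rewrite eulerian2.
  have -> : (1 + 'X)%:P * L ^+ 2 + a ^+ 2 + x ^+ 1 * be ^+ 2 - 2%:R * (L * Lam ^+ 1)
          = M * (L - a) + M * (L - be).
    have -> : L * Lam ^+ 1 = (a + M) * a + (x * be + M) * be.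
      by rewrite expr1 -xL /Lam /L; ring.
    rewrite polyCD polyC1 expr2 mulrA eL /L /Lam expr1.
    have e : x * be * (a + M) = be * (x * be + M) by rewrite -xL /L; ring.
    transitivity (a * (a + M) + x * be * (a + M) + 2%:R * M * (a + M) + a ^+ 2 + x * be ^+ 2 -
        2%:R * ((a + M) * a + (x * be + M) * be)); first by ring.
    by rewrite e; ring.
  by apply: nngD; apply: nngM.
have Lpow q : nng (L ^+ q) by apply: nngX.
have hLa : nng (L * Lam ^+ m.+1 - a ^+ m.+2).
  rewrite [a ^+ _]exprS; apply: nng_mul_sub => //; first exact: nngX.
  apply: nng_exp_sub => //; by rewrite /Lam addrC addKr; apply: nngM.
have hLb : nng (L * Lam ^+ m.+1 - x ^+ m.+1 * be ^+ m.+2).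
  have -> : x ^+ m.+1 * be ^+ m.+2 = be * (x * be) ^+ m.+1 by rewrite exprMn [be ^+ m.+2]exprS; ring.
  apply: nng_mul_sub => //; first by apply: nngX; apply: nngM.
  by apply: nng_exp_sub; [apply: nngM|rewrite /Lam addrK].
(* Multiplying the induction hypothesis by (1 + x) L leaves the negative cross terms x be a^(m+2)
   and x^(m+1) a be^(m+2). The monomials x and x^(m+1) split off from the Eulerian surplus, times
   L^(m+3), dominate them. *)
have -> : eulz m.+3 * L ^+ m.+3 + a ^+ m.+3 + x ^+ m.+2 * be ^+ m.+3
     - 2%:R * (L * Lam ^+ m.+2) =
  (eulerian m.+3 - (1 + 'X) * eulerian m.+2 - 'X - 'X^(m.+1))%:P * L ^+ m.+3
  + (1 + x) * L * (eulz m.+2 * L ^+ m.+2 + a ^+ m.+2 + x ^+ m.+1 * be ^+ m.+2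
       - 2%:R * (L * Lam ^+ m.+1))
  + 2%:R * (M * (L * Lam ^+ m.+1 - a ^+ m.+2))
  + 2%:R * (M * (L * Lam ^+ m.+1 - x ^+ m.+1 * be ^+ m.+2))
  + (M * L ^+ m.+2 + x * be * (L ^+ m.+2 - a ^+ m.+2))
  + x ^+ m.+1 * (L * L ^+ m.+2 - a * be ^+ m.+2).
  have -> : M * L ^+ m.+2 + x * be * (L ^+ m.+2 - a ^+ m.+2)
     = (x * L) * L ^+ m.+2 - x * be * a ^+ m.+2 by rewrite xL; ring.
  have -> : Lam ^+ m.+2 = ((1 + x) * L - 2%:R * M) * Lam ^+ m.+1.
    by rewrite eL addrK exprS.
  have e3 q : q ^+ m.+3 = q * q ^+ m.+2 :> {poly K} by rewrite exprS.
  rewrite 2!(polyCB (_ - _)) polyC_sub_1DX_mul rmorphXn /= !e3 ![x ^+ m.+2]exprS.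
  move: (Lam ^+ m.+1) (x ^+ m.+1) (L ^+ m.+2) (a ^+ m.+2) (be ^+ m.+2).
  move: (eulz m.+3) (eulz m.+2) => A' A lam xm Lm am bm.
  have -> : a = L - M by rewrite /L addrK.
  by rewrite ML; ring.
apply: nngD; first apply: nngD; first apply: nngD; first apply: nngD; first apply: nngD.
- by apply: nngM => //; apply: nngC => j; apply: eulerianS_gt.
- by apply: nngM => //; rewrite eL; apply: nngD => //; apply: nng2.
- by apply: nng2; apply: nngM.
- by apply: nng2; apply: nngM.
- apply: nngD; first exact: nngM.
  by apply: nngM; [apply: nngM|apply: nng_exp_sub].
- apply: nngM; first exact: nngX.
  by apply: nng_mul_sub => //; [apply: nngX|apply: nng_exp_sub].
Qed.

(* [a ^+ m] and [x ^+ m.-1 * be ^+ m] only live on the boundary monomials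
   [z^j] and [x^(j-1) z^j], where the inequality without them is false. *)
Lemma ehrhart_coef_ge (Q : {poly K}) m : nng Q -> nng (Q - 1) ->
  nng (eulz m.+1 * Q * L ^+ m.+1 + a ^+ m.+1 + x ^+ m * be ^+ m.+1
       - (Q + 1) * (Rr * Lam ^+ m)).
Proof.
move=> Q0 Q1.
have RL : nng (L * Lam ^+ m - Rr * Lam ^+ m).
  by rewrite -mulrBl; apply: nngM => //; apply: nngX.
(* With Q = (Q - 1) + 1, the bound without the factor 2 suffices on Q - 1; the doubled bound is
   needed only on the summand 1. *)
have -> : eulz m.+1 * Q * L ^+ m.+1 + a ^+ m.+1 + x ^+ m * be ^+ m.+1
       - (Q + 1) * (Rr * Lam ^+ m) =
   (Q - 1) * ((eulz m.+1 * L ^+ m.+1 - L * Lam ^+ m) + (L * Lam ^+ m - Rr * Lam ^+ m))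
   + (eulz m.+1 * L ^+ m.+1 + a ^+ m.+1 + x ^+ m * be ^+ m.+1
       - 2%:R * (Rr * Lam ^+ m)) by ring.
apply: nngD; first by apply: nngM => //; apply: nngD => //; apply: euler_log_ge.
(* At exponent 0 the claim is [LR2] itself; for larger exponents R is first replaced by L. *)
case: m RL => [_|m RL].
  rewrite eulerian1.
  by rewrite !mul1r !expr1 mulr1.
rewrite -[X in nng X](subrK (2%:R * (L * Lam ^+ m.+1 - Rr * Lam ^+ m.+1))).
apply: nngD; last exact: nng2.
have := euler_log_ge2 m; congr nng; ring.
Qed.
End MainInequality.

(** * The generating series *)

Section Geometric.
Variables (R : comNzRingType) (N : nat).
Implicit Types c : R.

Definition geo (c : R) : {poly R} := \poly_(i < N) c ^+ i.

Lemma eqtr_geo c : eqtr N ((1 - c%:P * 'X) * geo c) 1.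
Proof.
move=> i iN; rewrite mulrBl mul1r coefB -mulrA coefCM coefXM !coef_poly iN coef1.
case: i iN => [|i] iN /=; first by rewrite mulr0 subr0.
by rewrite (ltnW iN) exprS subrr.
Qed.

Lemma geo0 c : (0 < N)%N -> (geo c)`_0 = 1.
Proof. by move=> N0; rewrite coef_poly N0 expr0. Qed.

Lemma geo_deriv c : eqtr N.-1 (geo c)^`() (c%:P * geo c ^+ 2).
Proof.
have h : eqtr N.-1 ((1 - c%:P * 'X) * geo c) 1 by apply: eqtrW (eqtr_geo c); exact: leq_pred.
have hd := eqtr_deriv (eqtr_geo c); move: hd; rewrite derivM derivB !derivC derivM derivC derivX.
rewrite !mul0r !add0r mulr1 => hd.
have h1 := eqtrM h (eqtr_refl N.-1 ((geo c)^`())).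
rewrite mul1r in h1; apply: eqtr_trans (eqtr_sym h1) _.
have h2 := eqtrM hd (eqtr_refl N.-1 (geo c)); rewrite mul0r in h2.
have h3 := eqtrD h2 (eqtr_refl N.-1 (c%:P * geo c ^+ 2)); rewrite add0r in h3.
apply: eqtr_trans h3; set D := _^`(); apply: eqtr_eq; rewrite expr2; ring.
Qed.

Lemma coef_geoXS c y i : (i < N)%N -> (geo c ^+ y.+1)`_i = 'C(y + i, i)%:R * c ^+ i.
Proof.
elim: y i => [|y IH] i iN; first by rewrite expr1 coef_poly iN add0n binn mul1r.
have := eqtrM (eqtr_geo c) (eqtr_refl N (geo c ^+ y.+1)); rewrite mul1r -mulrA -exprS => h.
elim: i iN => [|i IHi] iN; have := h _ iN;
  rewrite mulrBl mul1r coefB -mulrA coefCM coefXM /= IH //.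
  by rewrite !bin0 mulr0 subr0.
move/eqP; rewrite subr_eq => /eqP ->; rewrite IHi ?(ltnW iN) //.
have -> : 'C(y.+1 + i.+1, i.+1) = ('C(y + i.+1, i.+1) + 'C(y.+1 + i, i))%N.
  by rewrite addSn binS addSnnS.
by rewrite natrD exprS; ring.
Qed.

End Geometric.

Section Series.
Local Notation K := {poly rat}.
Local Notation x := ('X%:P : {poly K}).
Variable N : nat.

Local Notation geo := (geo N).
Let eqtr_geoK (c : K) : eqtr N ((1 - c%:P * 'X) * geo c) 1.
Proof. exact: eqtr_geo. Qed.
Let geo_derivK (c : K) : eqtr N.-1 (geo c)^`() (c%:P * geo c ^+ 2).
Proof. exact: geo_deriv. Qed.
Let geo0K (c : K) : (0 < N)%N -> (geo c)`_0 = 1.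
Proof. exact: geo0. Qed.

(** The truncation of -log(1 - c z); its constant term vanishes because the inverse of 0 is 0. *)
Definition lg (c : K) : {poly K} := \poly_(i < N) (i%:R^-1 *: c ^+ i).

Lemma lg0 c : (lg c)`_0 = 0.
Proof. by rewrite coef_poly invr0 scale0r; case: ifP. Qed.

Lemma lg_deriv c : eqtr N.-1 (lg c)^`() (c%:P * geo c).
Proof.
move=> i iN; rewrite coef_deriv coefCM !coef_poly.
have -> : (i.+1 < N)%N by lia.
have -> : (i < N)%N by lia.
rewrite -scaler_nat scalerA mulfV ?scale1r ?pnatr_eq0 //.
by rewrite exprS.
Qed.

(* 1/((1-z)(1-xz)) and (1-xz)/(1-z), and the logarithm of the former. *)
Definition qser : {poly K} := geo 1 * geo 'X.
Definition wser : {poly K} := (1 - x * 'X) * geo 1.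
Definition logsum : {poly K} := lg 1 + lg 'X.

Lemma eqtr_qser : eqtr N ((1 - 'X) * (1 - x * 'X) * qser) 1.
Proof.
have := eqtrM (eqtr_geoK 1) (eqtr_geoK 'X); rewrite mul1r.
rewrite polyC1 mul1r => h; apply: eqtr_trans h ; apply: eqtr_eq; rewrite /qser; ring.
Qed.

(** Since [logsum] is log Q, the coefficients of Q^y become polynomials in y; the Ehrhart
    polynomials arise this way. *)
Lemma qser_exp y : (0 < N)%N -> eqtr N (qser ^+ y) (expz N logsum y%:R).
Proof.
move=> N0; apply: eqtr_expz.
- by rewrite coefD !lg0 addr0.
- by rewrite coefM big_ord1 !geo0K ?mulr1.
rewrite derivM derivD.
apply: eqtr_trans (eqtrD (eqtrM (geo_derivK _) (eqtr_refl _ _)) (eqtrM (eqtr_refl _ _) (geo_derivK _))) _.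
apply: eqtr_sym.
apply: eqtr_trans (eqtrM (eqtrD (lg_deriv _) (lg_deriv _)) (eqtr_refl _ _)) _.
by apply: eqtr_eq; rewrite /qser; ring.
Qed.

Lemma wser_exp y : (0 < N)%N -> eqtr N (wser ^+ y) (expz N (lg 1 - lg 'X) y%:R).
Proof.
move=> N0; apply: eqtr_expz.
- by rewrite coefB !lg0 subr0.
- by rewrite coefM big_ord1 geo0K // mulr1 coefB coef1 coefCM coefX mulr0 subr0.
rewrite [wser^`()]derivM.
apply: eqtr_trans (eqtrD (eqtr_refl _ _) (eqtrM (eqtr_refl _ _) (geo_derivK _))) _.
apply: eqtr_sym; rewrite derivB.
apply: eqtr_trans (eqtrM (eqtrB (lg_deriv _) (lg_deriv _)) (eqtr_refl _ _)) _.
rewrite derivB derivM !derivC derivX /wser.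

have h : eqtr N.-1 ((1 - x * 'X) * geo 'X) 1 by apply: eqtrW (eqtr_geoK _); exact: leq_pred.
have h' := eqtrM (eqtr_refl N.-1 (- x * geo 1)) h.
rewrite polyC1 !mul1r.
apply: (eqtr_trans (geo 1 * (1 - x * 'X) * geo 1 + (- x * geo 1) * ((1 - x * 'X) * geo 'X))).
  by apply: eqtr_eq; ring.
apply: eqtr_trans (eqtrD (eqtr_refl _ _) h') _.
by apply: eqtr_eq; rewrite mul0r add0r mulr1 expr2; ring.
Qed.

Definition lser : {poly K} := \poly_(j < N) (j%:R^-1 *: \sum_(i < j) 'X^i).
Definition bser : {poly K} := \poly_(j < N) (j%:R^-1 *: 'X^(j.-1)).
(* The closed form of [logsum / (1 + x - x z)], see [eqtr_rser]. *)
Definition rser : {poly K} :=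
  \poly_(j < N) \poly_(i < j) ((i`! * (j.-1 - i)`!)%:R / j`!%:R).

Lemma lgX : lg 'X = x * bser.
Proof.
apply/polyP => j; rewrite coefCM !coef_poly; case: ifP => _; last by rewrite mulr0.
case: j => [|j]; first by rewrite invr0 !scale0r mulr0.
by rewrite -scalerAr exprS.
Qed.

Lemma lser_mul : (1 - x) * lser = lg 1 - lg 'X.
Proof.
apply/polyP => j; rewrite -polyC1 -polyCB coefCM coefB !coef_poly; case: ifP => _; last by rewrite mulr0 subr0.
rewrite -scalerBr -scalerAr; congr (_ *: _).
by rewrite expr1n -[RHS]opprB subrX1 -mulNr opprB.
Qed.

(** With M defined as x L - b, this gives L = a + M, while x L = b + M holds by definition. *)
Lemma lser_lg : lser = lg 1 + (x * lser - x * bser).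
Proof. by have := lser_mul; rewrite -lgX mulrBl mul1r => /(canRL (subrK _)) => {1}->; ring. Qed.

Lemma nng_lg1 : nng (lg 1).
Proof.
move=> i j; rewrite coef_poly; case: ifP; rewrite ?coef0 // => _.
by rewrite expr1n coefZ coef1 mulr_ge0 ?ler0n ?invr_ge0.
Qed.

Lemma nng_bser : nng bser.
Proof.
move=> i j; rewrite coef_poly; case: ifP; rewrite ?coef0 // => _.
by rewrite coefZ coefXn mulr_ge0 ?ler0n ?invr_ge0.
Qed.

Lemma coef_sumXn n j : (\sum_(i < n) 'X^i : K)`_j = (j < n)%:R.
Proof.
transitivity ((\poly_(i < n) 1 : K)`_j); last by rewrite coef_poly; case: ifP.
by rewrite poly_def; congr (polyseq _)`_j; apply: eq_bigr => i _; rewrite scale1r.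
Qed.

Lemma nng_lser_sub : nng (x * lser - x * bser).
Proof.
move=> i j; rewrite coefB !coefCM !coef_poly; case: ifP => _; last by rewrite mulr0 subrr coef0.
case: i => [|i]; first by rewrite invr0 !scale0r !mulr0 subrr coef0.
rewrite -!scalerAr -scalerBr coefZ mulr_ge0 ?invr_ge0 ?ler0n // coefB !coefXM coefXn coef_sumXn.
by case: j => [|j] /=; rewrite ?subrr // subr_ge0 ler_nat; lia.
Qed.

Lemma nng_lser_bser : nng (lser - bser).
Proof.
move=> i j; rewrite coefB !coef_poly; case: ifP => _; last by rewrite subrr coef0.
case: i => [|i]; first by rewrite invr0 !scale0r subr0 coef0.
rewrite -scalerBr coefZ mulr_ge0 ?invr_ge0 ?ler0n // coefB coefXn coef_sumXn.
by rewrite subr_ge0 ler_nat; lia.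
Qed.

Lemma coef_rser j i : (rser`_j)`_i =
  if (i < j < N)%N then j%:R^-1 / 'C(j.-1, i)%:R else 0.
Proof.
rewrite coef_poly; case: (ltnP j N) => jN; last by rewrite coef0 andbF.
rewrite coef_poly andbT; case: ifP => // ij.
case: j ij jN => // j ij _ /=.
have h1 : 'C(j, i)%:R != 0 :> rat by rewrite pnatr_eq0 -lt0n bin_gt0; lia.
have h2 : i`!%:R != 0 :> rat by rewrite pnatr_eq0 -lt0n fact_gt0.
have h3 : (j - i)`!%:R != 0 :> rat by rewrite pnatr_eq0 -lt0n fact_gt0.
have h4 : j.+1%:R != 0 :> rat by rewrite pnatr_eq0.
rewrite factS -(bin_fact (m := i) (n := j)); last by lia.
have e4 : j.+1%:R = 1 + j%:R :> rat by rewrite nat1r.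
rewrite !natrM; move: h4; rewrite e4 => h4.
by field; rewrite h1 h2 h3 h4.
Qed.

Lemma nng_rser : nng rser.
Proof.
move=> j i; rewrite coef_rser; case: ifP => // _.
by rewrite mulr_ge0 // invr_ge0 ler0n.
Qed.

Lemma coef_lser j i : (lser`_j)`_i = if (i < j < N)%N then j%:R^-1 else 0.
Proof.
rewrite coef_poly; case: (ltnP j N) => jN; last by rewrite coef0 andbF.
by rewrite coefZ coef_sumXn andbT; case: ifP; rewrite ?mulr1 ?mulr0.
Qed.

Lemma nng_lser_rser : nng (lser - rser).
Proof.
move=> j i; rewrite !coefB coef_rser coef_lser; case: ifP => [/andP[ij _]|]; last by rewrite subrr.
rewrite subr_ge0 ler_piMr ?invr_ge0 //.
by rewrite invf_le1 ?ltr0n ?ler1n bin_gt0; lia.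
Qed.

(** In the interior the binomial in [coef_rser] is at least 2; at i = 0 and i = j - 1 it equals 1,
    and [lg 1] and [bser] supply the second 1/j. *)
Lemma nng_lser_rser2 : nng (lser + lg 1 + bser - 2%:R * rser).
Proof.
have -> : 2%:R * rser = rser + rser by ring.
move=> j i; rewrite !coefD !coefN !coefD coef_rser coef_lser !coef_poly.
case: (ltnP j N) => jN; last by rewrite andbF !coef0 ?(addr0,oppr0).
rewrite andbT expr1n !coefZ coef1 coefXn.
case: j jN => [|j] jN /=; first by rewrite invr0 !mul0r ?(addr0,oppr0).
have j0 : 0 <= j.+1%:R^-1 :> rat by rewrite invr_ge0.
set u := _^-1 in j0 *.
case: ifP => ij; last first.
  by rewrite ?(addr0, oppr0, add0r); apply: addr_ge0; apply: mulr_ge0.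
have [/andP[i0 ij']|e] := boolP (0 < i < j)%N.
  have -> : (i == 0)%N = false by lia.
  have -> : (i == j)%N = false by lia.
  have hC : (2 <= 'C(j, i))%N.
    case: i j {jN j0 u ij} i0 ij' => [|i] [|j] // _ ij; rewrite binS.
    have : (0 < 'C(j, i.+1))%N by rewrite bin_gt0; lia.
    have : (0 < 'C(j, i))%N by rewrite bin_gt0; lia.
    lia.
  have : ('C(j, i)%:R)^-1 <= 2%:R^-1 :> rat by rewrite lef_pV2 ?posrE ?ltr0n ?ler_nat //; lia.
  by rewrite !mulr0 !addr0; nra.
have -> : 'C(j, i) = 1%N.
  have [->|->] : i = 0 \/ i = j by lia.
    by rewrite bin0.
  by rewrite binn.
rewrite divr1.
have [i0|ij'] : i = 0 \/ i = j by lia.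
  rewrite i0 /= mulr1; have : 0 <= u * (0 == j)%:R by rewrite mulr_ge0.
  lra.
rewrite ij' eqxx /= mulr1; have : 0 <= u * (j == 0)%:R by rewrite mulr_ge0.
lra.
Qed.

(** The coefficients of [rser] are the Beta values B(i+1, j-i), and B(i+1, j-i) + B(i, j-i+1) = B(i,
    j-i) cancels everything with 0 < i < j. *)
Lemma eqtr_rser : eqtr N ((1 + x - x * 'X) * rser) logsum.
Proof.
move=> j jN; apply/polyP => i.
have -> : (1 + x - x * 'X) * rser = rser + x * rser - x * ('X * rser) by ring.
rewrite /logsum !(coefB, coefD, coefCM, coefXM).
have -> : (if j == 0 then 0 else rser`_j.-1)`_i.-1 =
   if j == 0 then 0 else (rser`_j.-1)`_i.-1 by case: ifP; rewrite ?coef0.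
rewrite !coef_rser !coef_poly jN andbT expr1n !coefZ coef1 coefXn.
have -> : (j.-1 < N)%N by lia.
case: j jN => [|j] jN; first by rewrite invr0 /= !mul0r; case: ifP; rewrite ?(addr0, oppr0).
case: i => [|i] /=.
  by rewrite bin0 !divr1 mulr0 subr0.
rewrite !andbT !ltnS mulr0 add0r eqSS.
have [ij|ji|->] := ltngtP i j.
- case: j ij jN => [//|j] ij jN.
  have h1 : 'C(j.+1, i.+1)%:R != 0 :> rat by rewrite pnatr_eq0 -lt0n bin_gt0; lia.
  have h2 : 'C(j.+1, i)%:R != 0 :> rat by rewrite pnatr_eq0 -lt0n bin_gt0; lia.
  have h3 : 'C(j, i)%:R != 0 :> rat by rewrite pnatr_eq0 -lt0n bin_gt0; lia.
  have e1 : j.+1%:R * 'C(j, i)%:R = i.+1%:R * 'C(j.+1, i.+1)%:R :> rat.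
    by rewrite -!natrM (mul_bin_diag j.+1).
  have e2 : j.+1%:R * 'C(j, i)%:R = (j.+1%:R - i%:R) * 'C(j.+1, i)%:R :> rat.
    by rewrite -natrB -?natrM ?(mul_bin_down j.+1) //; lia.
  have h4 : j.+1%:R != 0 :> rat by rewrite pnatr_eq0.
  have h5 : j.+2%:R != 0 :> rat by rewrite pnatr_eq0.
  have e3 : 'C(j.+1, i.+1)%:R^-1 = i.+1%:R / (j.+1%:R * 'C(j, i)%:R) :> rat.
    by rewrite e1 invfM mulrA mulfV ?mul1r // pnatr_eq0.
  have h6 : j.+1%:R - i%:R != 0 :> rat by rewrite subr_eq0 eqr_nat; lia.
  have e4 : 'C(j.+1, i)%:R^-1 = (j.+1%:R - i%:R) / (j.+1%:R * 'C(j, i)%:R) :> rat.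
    by rewrite e2 invfM mulrA mulfV ?mul1r.
  rewrite e3 e4 mulr0.
  have e q : q.+1%:R = 1 + q%:R :> rat by rewrite nat1r.
  move: h4 h5; rewrite !e => h4 h5.
  by field; rewrite h3 h4 h5.
- by rewrite mulr0 !addr0 ?subr0 ?addr0.
- by rewrite binn !divr1 add0r subr0.
Qed.

End Series.

Lemma coef_mulXn_lt0 (R : nzRingType) (p q : {poly R}) m i :
  p`_0 = 0 -> q`_0 = 0 -> (i <= m)%N -> (p * q ^+ m)`_i = 0.
Proof.
move=> p0 q0 im; rewrite coefM big1 // => -[[|j] jl] _ /=; first by rewrite p0 mul0r.
by rewrite coefXn_lt0 ?mulr0 //; lia.
Qed.

Lemma coef_mulXn_lt (R : nzRingType) (p q : {poly R}) m i :
  q`_0 = 0 -> (i < m)%N -> (p * q ^+ m)`_i = 0.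
Proof.
move=> q0 im; rewrite coefM big1 // => -[j jl] _ /=.
by rewrite coefXn_lt0 ?mulr0 //; lia.
Qed.

Lemma binD_fact p q : 'C(p + q, p)%:R = (p + q)`!%:R / (p`!%:R * q`!%:R) :> rat.
Proof.
rewrite -(@bin_fact (p + q) p) ?leq_addr // addKn 2!natrM mulfK //.
by rewrite mulf_neq0 // pnatr_eq0 -lt0n fact_gt0.
Qed.

(** Collapses a difference of two coefficients of (1 - x z)^y / (1 - z)^(y+1), for consecutive y,
    into one inclusion-exclusion term. *)
Lemma bin_uniform_diff n j y : (j < n)%N ->
  ('C(y.+1, j) * 'C(y.+1 + (n - j), n - j) =
   'C(y, j) * 'C(y + (n - j), n - j) + 'C(n, j) * 'C(y + (n - j), n.-1))%N.
Proof.
move=> jn; have [jy|yj] := leqP j y; last first.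
  rewrite [X in (_ = X * _ + _)%N]bin_small // mul0n add0n.
  have [e|ne] := eqVneq j y.+1; last first.
    by rewrite (@bin_small y.+1) 1?(@bin_small _ n.-1) ?muln0 //; lia.
  have -> : (y + (n - j) = n.-1)%N by lia.
  have -> : (y.+1 + (n - j) = n)%N by lia.
  by rewrite e !binn mul1n muln1 -e bin_sub // ltnW.
have [a ya] : exists a, y = (j + a)%N by exists (y - j)%N; lia.
have [b nb] : exists b, n = (j + b.+1)%N by exists (n - j).-1; lia.
rewrite {}ya {}nb {jn jy} addKn.
have f0 m : m`!%:R != 0 :> rat by rewrite pnatr_eq0 -lt0n fact_gt0.
have s0 m : m.+1%:R != 0 :> rat by rewrite pnatr_eq0.
apply/eqP; rewrite -(eqr_nat rat) natrD !natrM; apply/eqP.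
have -> : (j + a).+1 = (j + a.+1)%N by rewrite addnS.
have -> : 'C(j + a + b.+1, (j + b.+1).-1) = 'C((j + b) + a.+1, j + b).
  by rewrite addnS /=; congr 'C(_, _); lia.
rewrite ![in 'C(_ + b.+1, b.+1)]addnC.
rewrite !binD_fact.
have -> : (b.+1 + (j + a.+1) = (a + b + j).+2)%N by lia.
have -> : (b.+1 + (j + a) = (a + b + j).+1)%N by lia.
have -> : (j + b + a.+1 = (a + b + j).+1)%N by lia.
have -> : (j + b.+1 = (j + b).+1)%N by lia.
rewrite !(addnS j) !factS !natrM.
have e q : q.+1%:R = 1 + q%:R :> rat by rewrite nat1r.
have := (s0 (j + a)%N, s0 (j + b)%N, s0 a, s0 b, s0 (a + b + j)%N, s0 (a + b + j).+1).
have := (f0 (j + a)%N, f0 (j + b)%N, f0 a, f0 b, f0 j, f0 (a + b + j)%N).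
rewrite !e !natrD.
move: (j + a)`!%:R (j + b)`!%:R (a + b + j)`!%:R a`!%:R b`!%:R j`!%:R => A B C D E F.
case=> [[[[[h1 h2] h3] h4] h5] h6] [[[[[g1 g2] g3] g4] g5] g6].
by field; rewrite ?h1 ?h2 ?h3 ?h4 ?h5 ?h6 ?g1 ?g2 ?g3 ?g4 ?g5 ?g6.
Qed.

(** * Power sums of Q and coefficient extraction *)

Section Eval.
Local Notation K := {poly rat}.
Local Notation x := ('X%:P : {poly K}).
Variable N : nat.
Hypothesis N0 : (0 < N)%N.
Local Notation Q := (qser N).
Local Notation W := (wser N).
Local Notation Lam := (logsum N).
Local Notation L := (lser N).
Local Notation Rr := (rser N).

(** The truncation of (exp(y P) - 1)/P. *)
Definition expz1 (P : {poly K}) (y : rat) : {poly K} :=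
  \sum_(m < N.-1) ratCC (y ^+ m.+1 / m.+1`!%:R) * P ^+ m.

Lemma expz_expz1 P y : expz N P y = 1 + P * expz1 P y.
Proof.
rewrite /expz /expz1; case: N N0 => // M _ /=.
rewrite big_ord_recl /= expr0 expr0 fact0 divr1 mulr1 /ratCC !polyC1; congr (_ + _).
by rewrite big_distrr /=; apply: eq_bigr => i _; rewrite /bump /= add1n [P ^+ _.+1]exprS mulrCA.
Qed.

(** Multiplied by 1 + x - x z, both sides become Q^t - 1: the left telescopes since (1 + x - x z) z
    Q = Q - 1, and on the right (1 + x - x z) R = log Q. *)
Lemma eqtr_qser_geo t :
  eqtr N ('X * \sum_(s < t) Q ^+ s.+1) (Rr * expz1 Lam t%:R).
Proof.
have c0 : (1 + x - x * 'X)`_0 != 0.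
  rewrite coefB coefD coef1 coefC coefMX /= subr0.
  apply/eqP => /polyP/(_ 0); rewrite coefD coef1 coefX coef0 addr0; exact/eqP/oner_neq0.
apply: eqtr_cancel c0 _.
apply: (eqtr_trans (Q ^+ t - 1)).
  elim: t => [|t IH].
    by rewrite big_ord0 !mulr0 expr0 subrr.
  rewrite big_ord_recr /= !mulrDr.
  have h : eqtr N ((1 + x - x * 'X) * ('X * Q ^+ t.+1)) (Q ^+ t * (Q - 1)).
    have := eqtrM (eqtr_refl N (Q ^+ t)) (eqtrB (eqtr_refl N Q) (@eqtr_qser N)).
    by apply: eqtr_trans; apply: eqtr_eq; rewrite exprS; ring.
  apply: eqtr_trans (eqtrD IH h) _.
  by apply: eqtr_eq; rewrite exprSr; ring.
apply: eqtr_trans (eqtrB (@qser_exp N t N0) (eqtr_refl N 1)) _.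
rewrite expz_expz1 addrC addKr mulrA.
by apply: eqtrM => //; apply: eqtr_sym; exact: (@eqtr_rser N).
Qed.

Lemma coef_qser_exp s i j : (i < N)%N -> (j <= i)%N ->
  ((Q ^+ s.+1)`_i)`_j = 'C(s + j, j)%:R * 'C(s + (i - j), i - j)%:R.
Proof.
move=> iN ji; rewrite /qser exprMn mulrC coefM coef_sum.
have jb : (j < i.+1)%N by [].
rewrite (bigD1 (Ordinal jb)) //= big1 ?addr0 => [|[l li] /eqP ne].
  rewrite !coef_geoXS; try lia.
  by rewrite expr1n mulr1 -!polyC_natr mulrAC -polyCM coefCM coefXn eqxx mulr1.
rewrite /= !coef_geoXS; try lia.
rewrite expr1n mulr1 -!polyC_natr mulrAC -polyCM coefCM coefXn.
case: eqP => [e|_]; last by rewrite mulr0.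
by case: ne; apply: val_inj => /=.
Qed.

Lemma coef_qser i j : (i < N)%N -> (j <= i)%N -> (Q`_i)`_j = 1.
Proof.
by move=> iN ji; have := coef_qser_exp 0 iN ji; rewrite expr1 !add0n !binn mulr1.
Qed.

Lemma coef_binx y i : ((1 - x * 'X) ^+ y)`_i = (-1) ^+ i *: ('C(y, i)%:R *: 'X^i) :> K.
Proof.
elim: y i => [|y IH] i.
  by case: i => [|i]; rewrite expr0 coef1 /= ?bin0 ?scale1r ?expr0 ?scale1r // scale0r scaler0.
rewrite exprS mulrBl mul1r -mulrA coefB coefCM coefXM.
case: i => [|i] /=; first by rewrite mulr0 subr0 IH !bin0.
rewrite !IH binS natrD scalerDl scalerDr; congr (_ + _).
by rewrite -!scalerAr -exprS [(-1) ^+ i.+1]exprS mulN1r scaleNr.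
Qed.

Lemma coef_binx_geo y i j : (j <= i < N)%N ->
  (((1 - x * 'X) ^+ y * geo N 1 ^+ y.+1)`_i)`_j
    = (-1) ^+ j * 'C(y, j)%:R * 'C(y + (i - j), i - j)%:R.
Proof.
move=> /andP[ji iN]; rewrite coefM coef_sum.
have jb : (j < i.+1)%N by [].
rewrite (bigD1 (Ordinal jb)) //= big1 ?addr0 => [|[l li] /eqP ne].
  rewrite coef_binx coef_geoXS; last by lia.
  by rewrite expr1n mulr1 -polyC_natr coefMC !coefZ coefXn eqxx mulr1.
rewrite /= coef_binx coef_geoXS; last by lia.
rewrite expr1n mulr1 -polyC_natr coefMC !coefZ coefXn.
case: eqP => [e|_]; last by rewrite !mulr0 mul0r.
by case: ne; apply: val_inj => /=.
Qed.

End Eval.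

(** * The Ehrhart polynomials *)

Section Polynomials.
Local Notation K := {poly rat}.
Local Notation x := ('X%:P : {poly K}).

(** The outer variable is z and the inner one x, so this is the coefficient of z^i x^j. *)
Definition bcoef (i j : nat) (P : {poly K}) : rat := (P`_i)`_j.

Lemma bcoef_sum i j (I : finType) (F : I -> {poly K}) :
  bcoef i j (\sum_l F l) = \sum_l bcoef i j (F l).
Proof. by rewrite /bcoef !coef_sum. Qed.

Lemma bcoefD i j P S : bcoef i j (P + S) = bcoef i j P + bcoef i j S.
Proof. by rewrite /bcoef !coefD. Qed.

Lemma bcoef_ratCC i j r P : bcoef i j (ratCC r * P) = r * bcoef i j P.
Proof. by rewrite /bcoef /ratCC !coefCM. Qed.

Lemma bcoef_eqtr N i j P S : eqtr N P S -> (i < N)%N -> bcoef i j P = bcoef i j S.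
Proof. by move=> h iN; rewrite /bcoef h. Qed.

(* Here [k = p + 1] and [n = p + q + 2]; the three polynomials below are
   i(U,t), i(T,t-1) and i(T,t). *)
Variables p q : nat.
Local Notation n' := (p + q).+1.
Local Notation N := (p + q).+3.
Local Notation Q := (qser N).
Local Notation W := (wser N).
Local Notation Lam := (logsum N).
Local Notation L := (lser N).
Local Notation Rr := (rser N).
Local Notation coefzx := (bcoef n' p).

Definition unif_poly : K :=
  \poly_(m < n'.+1) (coefzx ((eulerian m)%:P * Q * L ^+ m) / m`!%:R).
Definition min_poly_pred : K :=
  \poly_(m < n'.+1) (if m is m'.+1 then coefzx (Rr * Lam ^+ m') / m`!%:R else 0).
Definition min_poly : K :=
  \poly_(m < n'.+1) (if m is m'.+1 then coefzx (Q * (Rr * Lam ^+ m')) / m`!%:R else 1).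

Let lam0 : Lam`_0 = 0. Proof. by rewrite coefD !lg0 addr0. Qed.
Let r0 : Rr`_0 = 0. Proof. by apply/polyP => i; rewrite coef_rser ltn0 /= coef0. Qed.
Let l0 : L`_0 = 0. Proof. by apply/polyP => i; rewrite coef_lser ltn0 /= coef0. Qed.

(** R and Lam have no constant term in z, so R Lam^m starts at z^(m+1) and the last summand of
    [expz1] contributes nothing. *)
Lemma coefzx_expz1 G t : coefzx (G * (Rr * expz1 N Lam t)) =
  \sum_(m < n') t ^+ m.+1 / m.+1`!%:R * coefzx (G * (Rr * Lam ^+ m)).
Proof.
rewrite /expz1 !mulr_sumr bcoef_sum /= big_ord_recr /= [X in _ + X = _](_ : _ = 0).
  rewrite addr0; apply: eq_bigr => m _.
  by rewrite -bcoef_ratCC; congr bcoef; ring.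
rewrite mulrCA mulrCA [Rr * _]mulrCA mulrCA bcoef_ratCC.
rewrite /bcoef coefM big1 ?coef0 ?mulr0 // => i _.
by rewrite [X in _ * X]coef_mulXn_lt0 ?mulr0 //; lia.
Qed.

Lemma bcoef_qser_exp s : bcoef (p + q) p (Q ^+ s.+1) =
  'C(s + p, p)%:R * 'C(s + q, q)%:R.
Proof.
by rewrite /bcoef coef_qser_exp ?leq_addr //; [rewrite addKn|lia].
Qed.

Lemma min_poly_predE t : min_poly_pred.[t%:R] =
  \sum_(s < t) 'C(s + p, p)%:R * 'C(s + q, q)%:R.
Proof.
transitivity (coefzx ('X * \sum_(s < t) Q ^+ s.+1)).
  rewrite (bcoef_eqtr _ (@eqtr_qser_geo N _ t)) //.
  rewrite -[Rr * _]mul1r coefzx_expz1 horner_poly.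
  rewrite big_ord_recl mul0r add0r; apply: eq_bigr => m _.
  by rewrite mul1r /= /bump /= add1n; ring.
rewrite /bcoef coefXM /= -/(bcoef _ _ _) bcoef_sum.
by apply: eq_bigr => s _; rewrite bcoef_qser_exp.
Qed.

Lemma min_polyE t : min_poly.[t%:R] =
  \sum_(s < t.+1) 'C(s + p, p)%:R * 'C(s + q, q)%:R.
Proof.
transitivity (coefzx ('X * \sum_(s < t.+1) Q ^+ s.+1)); last first.
  rewrite /bcoef coefXM /= -/(bcoef _ _ _) bcoef_sum.
  by apply: eq_bigr => s _; rewrite bcoef_qser_exp.
(* Apart from s = 0 the sum is Q times the one ending at t - 1, whence the extra factor Q; the term
   z Q supplies the constant 1. *)
have -> : 'X * \sum_(s < t.+1) Q ^+ s.+1 = Q * ('X * \sum_(s < t) Q ^+ s.+1) + 'X * Q.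
  rewrite big_ord_recl /= expr1 mulrDr addrC; congr (_ + _).
  rewrite mulrCA; congr (_ * _); rewrite big_distrr /=.
  by apply: eq_bigr => i _; rewrite -exprS.
rewrite bcoefD (bcoef_eqtr _ (eqtrM (eqtr_refl _ Q) (@eqtr_qser_geo N _ t))) //.
rewrite coefzx_expz1 horner_poly big_ord_recl mulr1 [LHS]addrC; congr (_ + _).
  by apply: eq_bigr => m _; rewrite /= /bump /= add1n; ring.
by rewrite /bcoef coefXM /= coef_qser ?leq_addr //; lia.
Qed.

(* The signed terms of the inclusion-exclusion count of the hypersimplex. *)
Lemma bcoef_wser_exp y j : (j <= n')%N ->
  bcoef n' j ((1 - x) * Q * W ^+ y) =
  (-1) ^+ j * ('C(n'.+1, j) * 'C(y + n' - j, n'))%:R.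
Proof.
move=> jn.
(* Partial fractions: z (1 - x) Q = 1/(1 - z) - 1/(1 - x z). *)
have hXQ : eqtr N ('X * ((1 - x) * Q)) (geo N 1 - geo N 'X).
  have h1 := eqtrM (eqtr_geo (N := N) ('X : K)) (eqtr_refl N (geo N 1)).
  have h2 := eqtrM (eqtr_geo (N := N) (1 : K)) (eqtr_refl N (geo N 'X)).
  rewrite mul1r in h1; rewrite mul1r in h2.
  apply: eqtr_trans (eqtrB h1 h2); apply: eqtr_eq.
  by rewrite polyC1 /qser; ring.
case: y => [|y].
  rewrite expr0 mulr1 add0n mulrBl mul1r /bcoef !(coefB, coefCM, coefXM).
  case: j jn => [|j] jn.
    by rewrite coef_qser // subr0 bin0 subn0 binn mul1r.
  rewrite !coef_qser ?subrr //=; try lia.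
  by rewrite [X in (_ * X)%N]bin_small ?muln0 ?mulr0 //; lia.
have -> : bcoef n' j ((1 - x) * Q * W ^+ y.+1)
        = bcoef n'.+1 j ('X * ((1 - x) * Q) * W ^+ y.+1).
  by rewrite /bcoef -['X * _ * _]mulrA coefXM.
rewrite (bcoef_eqtr _ (eqtrM hXQ (eqtr_refl _ _))) //.
have h : eqtr N ((geo N 1 - geo N 'X) * W ^+ y.+1)
   ((1 - x * 'X) ^+ y.+1 * geo N 1 ^+ y.+2 - (1 - x * 'X) ^+ y * geo N 1 ^+ y.+1).
  rewrite mulrBl; apply: eqtrB.
    by apply: eqtr_eq; rewrite /wser exprMn [geo N 1 ^+ y.+2]exprS mulrCA.
  have := eqtrM (eqtr_geo (N := N) ('X : K)) (eqtr_refl N ((1 - x * 'X) ^+ y * geo N 1 ^+ y.+1)).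
  rewrite mul1r; apply: eqtr_trans; apply: eqtr_eq.
  by rewrite /wser exprMn [(1 - x * 'X) ^+ y.+1]exprS; ring.
rewrite (bcoef_eqtr _ h) // /bcoef !coefB !coef_binx_geo; try lia.
have e := @bin_uniform_diff n'.+1 j y ltac:(lia).
rewrite -!mulrA -mulrBr -!natrM e natrD addrC addKr.
by congr (_ * (_ * 'C(_, _))%:R); lia.
Qed.

(** Each alternating term is a coefficient of (1 - x) Q W^y with y = (k - j) t. Expanding W^y =
    exp(y (1 - x) L) gives terms y^m (1 - x)^(m+1) Q L^m / m!, and summing over j convolves them
    with the series of i^m x^i, which Worpitzky's identity turns into x A_m. *)
Lemma unif_polyE t : unif_poly.[t%:R] = \sum_(j < p.+1)
  (-1) ^+ j * ('C(n'.+1, j) * 'C((p.+1 - j) * t + n' - j, n'))%:R.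
Proof.
have hW y j : bcoef n' j ((1 - x) * Q * W ^+ y) =
    \sum_(m < n'.+1) y%:R ^+ m / m`!%:R * ((1 - 'X) ^+ m.+1 * (Q * L ^+ m)`_n')`_j.
  rewrite (bcoef_eqtr _ (eqtrM (eqtr_refl _ _) (@wser_exp N y _))) //.
  rewrite -lser_mul /expz mulr_sumr bcoef_sum big_ord_recr /= [X in _ + X = _](_ : _ = 0).
    rewrite addr0; apply: eq_bigr => m _.
    have -> : (1 - x) * Q * (ratCC (y%:R ^+ m / m`!%:R) * ((1 - x) * L) ^+ m) =
      ratCC (y%:R ^+ m / m`!%:R) * ((1 - 'X) ^+ m.+1)%:P * (Q * L ^+ m).
      by rewrite rmorphXn /= rmorphB /= polyC1 exprMn exprS; ring.
    by rewrite -mulrA bcoef_ratCC /bcoef coefCM.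
  rewrite mulrCA bcoef_ratCC exprMn.
  have -> : (1 - x) * Q * ((1 - x) ^+ n'.+1 * L ^+ n'.+1) =
     ((1 - x) * Q * (1 - x) ^+ n'.+1) * L ^+ n'.+1 by rewrite mulrA.
  by rewrite /bcoef coef_mulXn_lt // coef0 mulr0.
have -> : \sum_(j < p.+1)
  (-1) ^+ j * ('C(n'.+1, j) * 'C((p.+1 - j) * t + n' - j, n'))%:R =
  \sum_(j < p.+1) bcoef n' j ((1 - x) * Q * W ^+ ((p.+1 - j) * t)).
  by apply: eq_bigr => j _; rewrite bcoef_wser_exp //; have := ltn_ord j; lia.
under eq_bigr do rewrite hW.
rewrite exchange_big horner_poly; apply: eq_bigr => m _ /=.
set V := (Q * L ^+ m)`_n'.
transitivity (t%:R ^+ m / m`!%:R * ('X * eulerian m * V)`_p.+1).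
  rewrite -['X * _ * V]mulrA coefXM /= /bcoef -[_%:P * _ * _]mulrA coefCM -/V; ring.
have h := eqtrM (@eulerian_series N m) (eqtr_refl N V).
rewrite -h; last by lia.
rewrite -[_ * V]mulrA; set F := (1 - 'X) ^+ m.+1 * V.
(* The entry of index 0 was set to 0, which drops the summand j = p + 1 even when m = 0. *)
rewrite [_ * F]mulrC coefM mulr_sumr big_ord_recr /= subnn coef_poly /= !mulr0 addr0.
apply: eq_bigr => j _; rewrite coef_poly.
have jp := ltn_ord j.
have -> : (p.+1 - j < N)%N by lia.
have -> : (p.+1 - j == 0)%N = false by lia.
by rewrite natrM exprMn; ring.
Qed.

End Polynomials.

(** * Positivity and comparison of the coefficients *)

Section CoefficientBounds.
Local Notation K := {poly rat}.
Local Notation x := ('X%:P : {poly K}).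

(** Slope 0 describes the powers of a, slope 1 those of b. *)
Definition supp_line (c : nat) (P : {poly K}) :=
  forall i j, j != (c * i)%N -> bcoef i j P = 0.

Lemma supp_lineX c P m : supp_line c P -> supp_line c (P ^+ m).
Proof.
move=> h; elim: m => [|m IH] i j ij.
  rewrite expr0 /bcoef -polyC1 coefC; case: (i =P 0%N) ij => [->|_]; rewrite ?coef0 // muln0 coef1.
  by case: eqP.
rewrite exprS /bcoef coefM coef_sum big1 // => -[l /= li] _; rewrite coefM big1 // => -[u /= ui] _.
have [e1|ne] := eqVneq u (c * l)%N; last by rewrite [X in X * _](h l u) ?mul0r.
rewrite [X in _ * X](IH (i - l)%N (j - u)%N) ?mulr0 //.
by apply: contra ij => /eqP e; rewrite mulnBr in e; nia.
Qed.

Lemma supp_line_lg1 N : supp_line 0 (lg N 1).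
Proof.
move=> i j; rewrite mul0n /bcoef coef_poly => /negbTE j0.
by case: ifP; rewrite ?coef0 // expr1n coefZ coef1 j0 mulr0.
Qed.

Lemma supp_line_lgX N : supp_line 1 (lg N 'X).
Proof.
move=> i j; rewrite mul1n /bcoef coef_poly => /negbTE j0.
by case: ifP; rewrite ?coef0 // coefZ coefXn j0 mulr0.
Qed.

Definition mono (i j : nat) : {poly K} := ('X^j)%:P * 'X^i.

Lemma monoM i j i' j' : mono i j * mono i' j' = mono (i + i') (j + j').
Proof. by rewrite /mono !exprD polyCM; ring. Qed.

Lemma mono_exp i j m : mono i j ^+ m = mono (i * m) (j * m).
Proof. by rewrite /mono exprMn -exprM -rmorphXn -exprM. Qed.

Lemma bcoef_mono i j i' j' : bcoef i' j' (mono i j) = ((i' == i) && (j' == j))%:R.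
Proof.
rewrite /bcoef /mono coefCM coefXn; case: eqP => _; last by rewrite mulr0 coef0.
by rewrite mulr1 coefXn.
Qed.

Lemma nng_mono i j : nng (mono i j).
Proof. by move=> i' j'; rewrite -/(bcoef _ _ _) bcoef_mono ler0n. Qed.

Lemma nng_sub_mono P i j : nng P -> 1 <= bcoef i j P -> nng (P - mono i j).
Proof.
move=> hP h i' j'; rewrite !coefB subr_ge0 -!/(bcoef _ _ _) bcoef_mono.
by case: eqP => [->|_] /=; [case: eqP => [->|_]|]; rewrite // hP.
Qed.

Variables p q : nat.
Local Notation n' := (p + q).+1.
Local Notation N := (p + q).+3.
Local Notation Q := (qser N).
Local Notation Lam := (logsum N).
Local Notation L := (lser N).
Local Notation Rr := (rser N).

Lemma nng_qser : nng Q.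
Proof.
apply: nngM => i j; rewrite coef_poly; case: ifP; rewrite ?coef0 // => _.
  by rewrite expr1n coef1; case: eqP.
by rewrite coefXn.
Qed.

Lemma nng_logsum : nng Lam.
Proof.
apply: nngD; first exact: nng_lg1.
rewrite lgX; apply: nngM; last exact: nng_bser.
by apply: nngC => j; rewrite coefX.
Qed.

Lemma min_poly_pred_ge0 m : 0 <= (min_poly_pred p q)`_m.
Proof.
rewrite coef_poly; case: ifP => // _; case: m => // m.
rewrite mulr_ge0 ?invr_ge0 ?ler0n //.
by apply: nngM; [exact: nng_rser|apply: nngX; exact: nng_logsum].
Qed.

(** The target monomial is a product of monomials dominated by the factors: z^i x^j with j <= i for
    Q, z for R, and z or x z for each Lam. *)
Lemma min_poly_gt0 m : (m < n'.+1)%N -> 0 < (min_poly p q)`_m.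
Proof.
move=> mn; rewrite coef_poly mn; case: m mn => // m mn.
rewrite mulr_gt0 ?invr_gt0 ?ltr0n ?fact_gt0 //.
(* Of the m factors [Lam], l supply x z and the others z; Q supplies the remaining x^(p-l). *)
pose l := minn m p.
have e : mono n' p = mono (n' - m.+1) (p - l) * (mono 1 0 * (mono 1 1 ^+ l * mono 1 0 ^+ (m - l))).
  by rewrite !mono_exp !monoM; congr mono; rewrite /l; lia.
have lamX b : (b <= 1)%N -> nng (Lam - mono 1 b).
  move=> b1; apply: nng_sub_mono; first exact: nng_logsum.
  rewrite /bcoef coefD !coef_poly /= expr1n expr1 invr1 !scale1r coefD coef1 coefX.
  by case: b b1 => [|[|]].
have : nng (Q * (Rr * Lam ^+ m) - mono n' p).
  have -> : Lam ^+ m = Lam ^+ l * Lam ^+ (m - l).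
    by rewrite -exprD subnKC // geq_minl.
  rewrite e.
  have hl := nngX _ nng_logsum.
  apply: nng_mul_sub; first exact: nng_qser.
  - by apply: nngM; last (apply: nngM; apply: nngX); apply: nng_mono.
  - apply: nng_sub_mono; first exact: nng_qser.
    by rewrite /bcoef coef_qser // /l; lia.
  apply: nng_mul_sub; first exact: nng_rser.
  - by apply: nngM; apply: nngX; apply: nng_mono.
  - apply: nng_sub_mono; first exact: nng_rser.
    by rewrite /bcoef coef_rser /= bin0 invr1 mulr1.
  apply: nng_mul_sub => //; first by apply: nngX; apply: nng_mono.
  - by apply: nng_exp_sub; [apply: nng_mono|apply: lamX].
  - by apply: nng_exp_sub; [apply: nng_mono|apply: lamX].
move=> /(_ n' p); rewrite !coefB subr_ge0 -!/(bcoef _ _ _) bcoef_mono !eqxx /=.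
exact: lt_le_trans.
Qed.

Lemma min_poly_add_pred_le m : (0 < p)%N -> (0 < q)%N ->
  (min_poly p q)`_m + (min_poly_pred p q)`_m <= (unif_poly p q)`_m.
Proof.
move=> p0 q0; rewrite !coef_poly; case: ifP => // _; case: m => [|m].
  by rewrite fact0 divr1 addr0 /= polyC1 mul1r expr0 mulr1 /bcoef coef_qser //; lia.
rewrite -mulrDl ler_wpM2r ?invr_ge0 ?ler0n // -bcoefD.
have Q1 : nng (Q - 1).
  have -> : 1 = mono 0 0 by rewrite /mono !expr0 polyC1 mulr1.
  by apply: nng_sub_mono; [exact: nng_qser|rewrite /bcoef coef_qser].
have LM := @lser_lg N.
have := @ehrhart_coef_ge (lg N 1) (bser N) (x * L - x * bser N) Rr.
rewrite -LM -lgX => H.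
have {H} : 0 <= bcoef n' p ((eulerian m.+1)%:P * Q * L ^+ m.+1 + lg N 1 ^+ m.+1
       + x ^+ m * bser N ^+ m.+1 - (Q + 1) * (Rr * Lam ^+ m)).
  apply: H nng_qser Q1 _ _.
  - by rewrite addrC subrK.
  - exact: nng_lg1.
  - exact: nng_bser.
  - by rewrite lgX; exact: nng_lser_sub.
  - exact: nng_lser_bser.
  - exact: nng_lser_rser.
  - exact: nng_lser_rser2.
have e1 : bcoef n' p (lg N 1 ^+ m.+1) = 0.
  by apply: (@supp_lineX 0 _ m.+1 (@supp_line_lg1 N) n' p); rewrite mul0n; lia.
(* Times x, this is a power of b, supported on equal degrees in x and z; here they are p + 1 and p +
   q + 1, distinct because q > 0. *)
have e2 : bcoef n' p (x ^+ m * bser N ^+ m.+1) = 0.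
  have : bcoef n' p.+1 (x * (x ^+ m * bser N ^+ m.+1)) = 0.
    have -> : x * (x ^+ m * bser N ^+ m.+1) = lg N 'X ^+ m.+1.
      by rewrite mulrA -exprS lgX exprMn.
    by apply: (@supp_lineX 1 _ m.+1 (@supp_line_lgX N) n' p.+1); rewrite mul1n; lia.
  by rewrite /bcoef coefCM coefXM.
have eB P S : bcoef n' p (P - S) = bcoef n' p P - bcoef n' p S by rewrite /bcoef !coefB.
move=> H; rewrite eB 2!bcoefD e1 e2 !addr0 subr_ge0 in H; apply: le_trans H.
by rewrite mulrDl mul1r.
Qed.

End CoefficientBounds.

Local Close Scope ring_scope.

(** * Lattice points of dilated Schubert matroid polytopes *)

Section Polytope.
Variable n : nat.
Implicit Types S T B : {set 'I_n}.

Lemma sorted_sorted_elems S : sorted leq (sorted_elems S).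
Proof. exact: (sort_sorted leq_total). Qed.

Lemma count_sorted_elems (a : pred nat) S :
  count a (sorted_elems S) = #|[set i in S | a i]|.
Proof.
rewrite /sorted_elems count_sort count_map -size_filter cardE.
rewrite /enum_mem -filter_predI; congr size; apply: eq_filter => i /=.
by rewrite inE andbC.
Qed.

Lemma size_sorted_elems S : size (sorted_elems S) = #|S|.
Proof. by rewrite size_sort size_map -cardE. Qed.

Lemma nth_ltn_count (s : seq nat) i m : sorted leq s -> i < size s ->
  (nth 0 s i < m) = (i < count (fun v => v < m) s).
Proof.
move=> hs is_; apply/idP/idP => h; last exact: (@nth_count_lt _ nat m).
rewrite ltnNge; apply/negP => hc.
have := @nth_count_ge _ nat m 0 s i hs; rewrite hc is_ => /(_ isT).
by rewrite leEnat leqNgt h.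
Qed.

Definition tail_set (m : nat) S : {set 'I_n} := [set i in S | m <= i].

Lemma card_tail_set m S : #|tail_set m S| + #|[set i in S | i < m]| = #|S|.
Proof.
rewrite -[RHS](cardsID [set i : 'I_n | m <= i]); congr (_ + _); apply: eq_card => i;
  by rewrite !inE // andbC ltnNge.
Qed.

(** Comparing sorted entries amounts to comparing counts below every threshold; the resulting tail
    conditions are linear and pass to the polytope. *)
Lemma gale_leP S T : reflect
  (#|T| = #|S| /\ forall m, #|tail_set m T| <= #|tail_set m S|) (gale_le T S).
Proof.
apply: (iffP andP) => -[].
  move=> /eqP eTS /forallP hT; split=> // m.
  have := card_tail_set m T; have := card_tail_set m S.
  rewrite -!(count_sorted_elems (fun v => v < m)).
  suff : count (fun v => v < m) (sorted_elems S) <= count (fun v => v < m) (sorted_elems T) by lia.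
  set c := count _ _; case e : c => [//|c'].
  have cS : c' < #|S| by have := count_size (fun v => v < m) (sorted_elems S); rewrite -/c e size_sorted_elems.
  have cn : c' < n by apply: leq_trans cS _; rewrite -[X in _ <= X]card_ord max_card.
  have /implyP/(_ _) := hT (Ordinal cn); rewrite /= eTS => /(_ cS) h.
  rewrite -nth_ltn_count ?sorted_sorted_elems ?size_sorted_elems ?eTS //.
  by apply: leq_ltn_trans h _; rewrite nth_ltn_count ?sorted_sorted_elems ?size_sorted_elems // -/c e.
move=> eTS h; split; first exact/eqP.
apply/forallP => i; apply/implyP => iT.
rewrite -ltnS nth_ltn_count ?sorted_sorted_elems ?size_sorted_elems //.
set m := (nth _ _ _).+1; have := card_tail_set m T; have := card_tail_set m S; have := h m.
rewrite -!(count_sorted_elems (fun v => v < m)).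
suff : i < count (fun v => v < m) (sorted_elems S) by lia.
by rewrite -nth_ltn_count ?sorted_sorted_elems ?size_sorted_elems -?eTS.
Qed.

Lemma card_tail_setE m B : #|tail_set m B| = \sum_(i < n | m <= i) (i \in B).
Proof.
rewrite -sum1_card [RHS]big_mkcond [LHS]big_mkcond /=; apply: eq_bigr => i _.
by rewrite inE; case: (i \in B); case: (m <= i).
Qed.

Lemma card_tail_set0 B : #|tail_set 0 B| = #|B|.
Proof. by apply: eq_card => i; rewrite inE andbT. Qed.

(** * Decomposition of a lattice point into t sets *)

Section Decomposition.
Variables (t : nat) (y : 'I_n -> nat).
Hypothesis y_le : forall i, y i <= t.

Definition prefix_sum (m : nat) : nat := \sum_(i < n | i < m) y i.
(* The number of [u < s] with [u = j %[mod t]]. *)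
Definition hits (j s : nat) : nat := s %/ t + (j < s %% t).
(* Lay intervals of lengths [y i] end to end: every residue class mod [t]
   selects the set of the intervals that it meets. *)
Definition layer (j : nat) : {set 'I_n} :=
  [set i : 'I_n | hits j (prefix_sum i) < hits j (prefix_sum i.+1)].

Lemma prefix_sumS (i : 'I_n) : prefix_sum i.+1 = prefix_sum i + y i.
Proof.
rewrite /prefix_sum (bigD1 i) //= addnC; congr (_ + _).
by apply: eq_bigl => l; rewrite ltnS -val_eqE /=; lia.
Qed.

(** No interval is longer than one period, so each residue class meets it at most once and
    multiplicities in a layer are 0 or 1. *)
Lemma hits_add (j s u : nat) : u <= t ->
  hits j s <= hits j (s + u) <= (hits j s).+1.
Proof.
move=> ut; have [t0|t0] := posnP t.
  by move: ut; rewrite t0 leqn0 => /eqP ->; rewrite addn0 leqnn leqnSn.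
rewrite /hits; have := ltn_pmod s t0; have := ltn_pmod (s + u) t0.
have := divn_eq s t; have := divn_eq (s + u) t.
move: (s %/ t) (s %% t) ((s + u) %/ t) ((s + u) %% t) => a r b r' e1 e2 r't rt.
have ba : b <= a.+1 by rewrite leqNgt; apply/negP => h; nia.
have ab : a <= b by rewrite leqNgt; apply/negP => h; nia.
have [eb|eb] : b = a \/ b = a.+1 by lia.
  by subst b; case: ltnP => ?; case: ltnP => ?; lia.
by subst b; case: ltnP => ?; case: ltnP => ?; lia.
Qed.

Lemma hits_homo j : {homo hits j : a b / a <= b}.
Proof.
move=> a b /subnKC <-; elim: (b - a) => [|u IH]; first by rewrite addn0.
apply: leq_trans IH _; rewrite addnS -addn1.
have [t0|t0] := posnP t; last by have /andP[] := @hits_add j (a + u) 1 t0.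
by rewrite /hits t0 !divn0 !modn0; case: ltnP => //; case: ltnP => //; lia.
Qed.

Lemma hits_mul j c : j < t -> hits j (c * t) = c.
Proof. by move=> jt; rewrite /hits modnMl addn0 mulnK //; lia. Qed.

Lemma sum_hits s : 0 < t -> \sum_(j < t) hits j s = s.
Proof.
move=> t0; rewrite /hits big_split /= sum_nat_const card_ord [RHS](divn_eq s t) mulnC.
congr (_ + _); have /ltnW rt := ltn_pmod s t0.
transitivity (\sum_(j < t | j < s %% t) 1); first by rewrite [RHS]big_mkcond.
by rewrite -(big_ord_widen _ (fun=> 1)) // sum1_card card_ord.
Qed.

Lemma mem_layer j (i : 'I_n) :
  nat_of_bool (i \in layer j) = hits j (prefix_sum i.+1) - hits j (prefix_sum i).
Proof.
rewrite inE; have := hits_add j (prefix_sum i) (y_le i); rewrite -prefix_sumS.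
by case: ltnP => ?; lia.
Qed.

Lemma prefix_sum_homo : {homo prefix_sum : a b / a <= b}.
Proof.
move=> a b ab; rewrite /prefix_sum [X in X <= _]big_mkcond [X in _ <= X]big_mkcond /=.
apply: leq_sum => i _; case: (ltnP i a) => // ia.
by rewrite (leq_trans ia ab).
Qed.

Lemma card_tail_layer j m : m <= n ->
  #|tail_set m (layer j)| = hits j (prefix_sum n) - hits j (prefix_sum m).
Proof.
move=> mn; rewrite card_tail_setE.
under eq_bigr do rewrite mem_layer.
rewrite -(@big_geq_mkord _ _ addn m n xpredT
  (fun i => hits j (prefix_sum i.+1) - hits j (prefix_sum i))).
rewrite (@telescope_sumn m n (fun i => hits j (prefix_sum i))) //.
by move=> a b ab; apply: hits_homo; apply: prefix_sum_homo.
Qed.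

Lemma sum_mem_layer (i : 'I_n) : \sum_(j < t) (i \in layer j) = y i.
Proof.
have [t0|t0] := posnP t.
  by rewrite big1 => [|[j jt]]; have := y_le i; lia.
under eq_bigr do rewrite mem_layer.
rewrite sumnB => [|j _]; first by rewrite !sum_hits // prefix_sumS addKn.
by apply: hits_homo; rewrite prefix_sumS leq_addr.
Qed.

Lemma prefix_sum_tail m : prefix_sum m + \sum_(i < n | m <= i) y i = \sum_(i < n) y i.
Proof.
rewrite [RHS](bigID (fun i : 'I_n => i < m)) /=; congr (_ + _).
by apply: eq_bigl => i; rewrite leqNgt.
Qed.

End Decomposition.

(** Necessity averages the tail bounds of the bases. Sufficiency is integer decomposition: the t
    layers of [y] are themselves bases and add up to [y]. *)
Lemma in_dilate_schubertP S t (y : 'I_n -> nat) : (forall i, y i <= t) ->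
  in_dilate (schubert_bases S) t y <->
  (\sum_i y i = #|S| * t /\ forall m, \sum_(i < n | m <= i) y i <= #|tail_set m S| * t).
Proof.
move=> y_le; split.
  case=> lam [lam0 lamB lamt lamy].
  have tail m : ((\sum_(i < n | m <= i) y i)%N%:R = \sum_(B : {set 'I_n}) lam B * #|tail_set m B|%:R)%R.
    rewrite natr_sum (eq_bigr _ (fun i _ => lamy i)) exchange_big /=.
    apply: eq_bigr => B _; rewrite -mulr_sumr card_tail_setE natr_sum.
    by congr (_ * _)%R; apply: eq_bigr => i _; case: (i \in B).
  have le m : \sum_(i < n | m <= i) y i <= #|tail_set m S| * t.
    rewrite -(ler_nat rat) tail natrM -lamt mulr_sumr; apply: ler_sum => B _.
    have [BS|BS] := boolP (B \in schubert_bases S); last by rewrite lamB // mul0r mulr0.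
    rewrite mulrC ler_wpM2r // ler_nat.
    by move: BS; rewrite inE => /gale_leP[_]; apply.
  split=> //; apply/eqP; rewrite -(eqr_nat rat); apply/eqP.
  have -> : \sum_i y i = \sum_(i < n | 0 <= i) y i by apply: eq_bigl.
  rewrite tail natrM -lamt mulr_sumr; apply: eq_bigr => B _.
  have [BS|BS] := boolP (B \in schubert_bases S); last by rewrite lamB // mul0r mulr0.
  by move: BS; rewrite inE => /gale_leP[<- _]; rewrite card_tail_set0 mulrC.
case=> ysum ytail.
pose lam : {ffun {set 'I_n} -> rat} := [ffun B => (\sum_(j < t) (layer t y j == B))%:R%R].
have card_layer (j : 'I_t) m : m <= n -> #|tail_set m (layer t y j)| = #|S| - hits t j (prefix_sum y m).
  move=> mn; rewrite card_tail_layer //; congr (_ - _).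
  have := prefix_sum_tail y n; rewrite big_pred0 => [|i]; last by have := ltn_ord i; lia.
  by rewrite addn0 ysum => ->; rewrite hits_mul.
exists lam; split.
- by move=> B; rewrite ffunE ler0n.
- move=> B; rewrite inE => BS; rewrite ffunE big1 // => j _.
  case: eqP => // e; case/negP: BS; apply/gale_leP; rewrite -{}e; split.
    rewrite -card_tail_set0 card_layer // /prefix_sum big_pred0 => [|i]; last by rewrite ltn0.
    by have := hits_mul 0 (ltn_ord j); rewrite mul0n => ->; rewrite subn0.
  move=> m; have [mn|nm] := leqP m n; last first.
    rewrite (_ : tail_set m _ = set0) ?cards0 //.
    by apply/setP => i; rewrite inE in_set0 leqNgt (ltn_trans (ltn_ord i) nm) andbF.
  rewrite card_layer //.
  (* [hits] is exact at multiples of t, so monotonicity transfers the bound on the prefix sum of [y]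
     to the layer. *)
  have := @hits_homo t j ((#|S| - #|tail_set m S|) * t) (prefix_sum y m).
  rewrite hits_mul // => h.
  suff /h : (#|S| - #|tail_set m S|) * t <= prefix_sum y m by lia.
  have := ytail m; have := prefix_sum_tail y m; rewrite ysum mulnBl; lia.
- under eq_bigr do rewrite ffunE.
  rewrite -natr_sum exchange_big /=; apply: (congr1 (fun u : nat => u%:R : rat)%R).
  under eq_bigr => j _.
    rewrite (bigD1 (layer t y j)) //= eqxx big1 => [|B /negbTE ne]; last by rewrite eq_sym ne.
    over.
  by rewrite sum_nat_const card_ord muln1.
- move=> i; under eq_bigr do rewrite ffunE.
  rewrite -(sum_mem_layer y_le i) natr_sum.
  under [RHS]eq_bigr do rewrite natr_sum mulr_suml.
  rewrite exchange_big /=; apply: eq_bigr => j _.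
  rewrite (bigD1 (layer t y j)) //= eqxx mul1r big1 ?addr0 // => B /negbTE ne.
  by rewrite eq_sym ne mul0r.
Qed.

End Polytope.

(** * Counting lattice points *)

Section EhrhartCounts.
Variables k n t : nat.
Implicit Types x : {ffun 'I_n -> 'I_t.+1}.
Local Notation X := {ffun 'I_n -> 'I_t.+1}.
Local Notation head x := (\sum_(i < n | i < k) (x : {ffun 'I_n -> 'I_t.+1}) i).
Local Notation tail x := (\sum_(i < n | k <= i) (x : {ffun 'I_n -> 'I_t.+1}) i).

Lemma sum_range (a b : nat) : b <= n -> \sum_(i < n) (a <= i < b) = b - a.
Proof.
move=> bn; suff -> : forall l, \sum_(i < l) (a <= i < b) = minn b l - a by lia.
by elim=> [|l IH]; rewrite ?big_ord0 ?big_ord_recr /= ?IH; lia.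
Qed.

Lemma card_tail_range m (S : {set 'I_n}) (a b a' b' : nat) : b <= n -> b' <= n ->
  (forall i : 'I_n, nat_of_bool ((i \in S) && (m <= i)) = (a <= i < b) + (a' <= i < b')) ->
  #|tail_set m S| = (b - a) + (b' - a').
Proof.
move=> bn bn' h; rewrite -!sum_range // -big_split /= -sum1_card [LHS]big_mkcond /=.
by apply: eq_bigr => i _; rewrite -h inE; case: ifP.
Qed.

Lemma sum_range_le (a b : nat) x : b <= n ->
  \sum_(i < n | a <= i < b) x i <= (b - a) * t.
Proof.
move=> bn; rewrite -sum_range // big_mkcond big_distrl /=; apply: leq_sum => i _.
by case: ifP => _; rewrite ?mul1n // -ltnS ltn_ord.
Qed.

Lemma ehrhart_count_schubert (S : {set 'I_n}) (P : pred {ffun 'I_n -> 'I_t.+1}) :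
  (forall x, P x <-> (\sum_i x i = #|S| * t /\
     forall m, \sum_(i < n | m <= i) x i <= #|tail_set m S| * t)) ->
  ehrhart_count (schubert_bases S) t = #|[set x : X | P x]|.
Proof.
move=> h; apply: eq_card => x; rewrite !inE; apply/asboolP/idP.
  by move/in_dilate_schubertP => H; apply/h/H => i; rewrite -ltnS ltn_ord.
by move/h => H; apply/in_dilate_schubertP => // i; rewrite -ltnS ltn_ord.
Qed.

Lemma tail_le_n m x : n <= m -> \sum_(i < n | m <= i) x i = 0.
Proof. by move=> nm; rewrite big_pred0 // => i; have := ltn_ord i; lia. Qed.

Lemma tail_range m x : \sum_(i < n | m <= i) x i = \sum_(i < n | m <= i < n) x i.
Proof. by apply: eq_bigl => i; rewrite ltn_ord andbT. Qed.

Lemma tail_split m x : m <= k ->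
  \sum_(i < n | m <= i) x i = \sum_(i < n | m <= i < k) x i + tail x.
Proof.
move=> mk; rewrite (bigID (fun i : 'I_n => i < k)) /=; congr (_ + _).
by apply: eq_bigl => i; lia.
Qed.

Lemma tail_le_all m x : \sum_(i < n | m <= i) x i <= \sum_i x i.
Proof. by rewrite [X in _ <= X](bigID (fun i : 'I_n => m <= i)) /= leq_addr. Qed.

Lemma tail_le_tail m x : k <= m -> \sum_(i < n | m <= i) x i <= tail x.
Proof.
move=> km; rewrite [X in X <= _]big_mkcond [X in _ <= X]big_mkcond /=.
by apply: leq_sum => i _; case: ifP => // mi; rewrite (leq_trans km mi).
Qed.

Lemma ehrhart_count_U : k <= n ->
  ehrhart_count (schubert_bases (U_set k n)) t = #|[set x : X | \sum_i x i == k * t]|.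
Proof.
move=> kn; apply: ehrhart_count_schubert => x.
have tailE m : #|tail_set m (U_set k n)| = (n - maxn m (n - k)) + (0 - 0).
  by apply: card_tail_range => // i; rewrite inE; have := ltn_ord i; lia.
have cardE : #|U_set k n| = k by rewrite -card_tail_set0 tailE; lia.
rewrite cardE; split=> [/eqP e|[-> _]]; last by [].
split=> // m; rewrite tailE; have [mk|mk] := leqP m (n - k).
  apply: leq_trans (tail_le_all m x) _; rewrite e leq_mul2r; apply/orP; right; lia.
rewrite tail_range; apply: leq_trans (sum_range_le _ _ _) _ => //.
by rewrite leq_mul2r; apply/orP; right; lia.
Qed.

(** Given the total, the tail inequality at m = k and the box bounds imply all the others. *)
Lemma ehrhart_count_T : 1 < k -> k + 2 <= n ->
  ehrhart_count (schubert_bases (T_set k n)) t =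
  #|[set x : X | (\sum_i x i == k * t) && (tail x <= t)]|.
Proof.
move=> k1 kn; apply: ehrhart_count_schubert => x.
have tailE m : #|tail_set m (T_set k n)| = (k - maxn m 1) + (n - maxn m n.-1).
  by apply: card_tail_range => //; [lia|move=> i; rewrite inE; have := ltn_ord i; lia].
have cardE : #|T_set k n| = k by rewrite -card_tail_set0 tailE; lia.
rewrite cardE; split=> [/andP[/eqP e xt]|[-> h]]; last first.
  rewrite eqxx /=; have := h k; rewrite tailE.
  have -> : (k - maxn k 1) + (n - maxn k n.-1) = 1 by lia.
  by rewrite mul1n.
split=> // m; rewrite tailE; have [km|mk] := leqP m k.
  case: m km => [|m] km.
    by apply: leq_trans (tail_le_all 0 x) _; rewrite e leq_mul2r; apply/orP; right; lia.
  rewrite tail_split //; have := @sum_range_le m.+1 k x ltac:(lia).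
  have -> : (k - maxn m.+1 1) + (n - maxn m.+1 n.-1) = (k - m.+1) + 1 by lia.
  by rewrite mulnDl; lia.
have [nm|mn] := leqP n m; first by rewrite tail_le_n.
apply: leq_trans (tail_le_tail _ (ltnW mk)) _; apply: leq_trans xt _.
by rewrite leq_pmull //; lia.
Qed.

Lemma ehrhart_count_Sp : 1 < k -> k + 2 <= n ->
  ehrhart_count (schubert_bases (Sp_set k n)) t =
  #|[set x : X | (\sum_i x i == (n - k) * t) && (tail x <= (n - k).-1 * t)]|.
Proof.
move=> k1 kn; apply: ehrhart_count_schubert => x.
have tailE m : #|tail_set m (Sp_set k n)| = (k - maxn m k.-1) + (n - maxn m k.+1).
  by apply: card_tail_range => //; [lia|move=> i; rewrite inE; have := ltn_ord i; lia].
have cardE : #|Sp_set k n| = n - k by rewrite -card_tail_set0 tailE; lia.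
rewrite cardE; split=> [/andP[/eqP e xt]|[-> h]]; last first.
  rewrite eqxx /=; apply: leq_trans (h k) _.
  by rewrite tailE leq_mul2r; apply/orP; right; lia.
split=> // m; rewrite tailE; have [km|mk] := ltnP m k.
  by apply: leq_trans (tail_le_all m x) _; rewrite e leq_mul2r; apply/orP; right; lia.
have [->|ne] := eqVneq m k.
  by apply: leq_trans xt _; rewrite leq_mul2r; apply/orP; right; lia.
have [nm|mn] := leqP n m; first by rewrite tail_le_n.
rewrite tail_range; apply: leq_trans (sum_range_le _ _ _) _ => //.
by rewrite leq_mul2r; apply/orP; right; lia.
Qed.

(* Complementing the coordinates in [I] turns all three counts into counts of
   points with equal head and tail sums. *)
Definition flip (I : pred 'I_n) x : {ffun 'I_n -> 'I_t.+1} :=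
  [ffun i => if I i then rev_ord (x i) else x i].

Lemma flipK I : involutive (flip I).
Proof. by move=> x; apply/ffunP => i; rewrite !ffunE; case: (I i); rewrite ?rev_ordK. Qed.

Lemma card_flip I (P P' : pred {ffun 'I_n -> 'I_t.+1}) :
  (forall x, P x = P' (flip I x)) -> #|[set x : X | P x]| = #|[set x : X | P' x]|.
Proof.
move=> h; rewrite -(on_card_preimset (f := flip I) (R := [set x | P' x])).
  by apply: eq_card => x; rewrite !inE h.
by apply: onW_bij; exists (flip I); apply: flipK.
Qed.

Lemma sum_flip_in (I J : pred 'I_n) x : (forall i, J i -> I i) ->
  \sum_(i | J i) (flip I x) i + \sum_(i | J i) x i = #|[set i | J i]| * t.
Proof.
move=> JI; rewrite -big_split /= -sum1_card big_distrl /= [RHS]big_mkcond [LHS]big_mkcond /=.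
apply: eq_bigr => i _; rewrite inE ffunE; case: ifP => // Ji.
by rewrite (JI _ Ji) /= mul1n; have := ltn_ord (x i); lia.
Qed.

Lemma sum_flip_out (I J : pred 'I_n) x : (forall i, J i -> ~~ I i) ->
  \sum_(i | J i) (flip I x) i = \sum_(i | J i) x i.
Proof. by move=> JI; apply: eq_bigr => i /JI /negbTE Ii; rewrite ffunE Ii. Qed.

Lemma card_head : k <= n -> #|[set i : 'I_n | i < k]| = k.
Proof.
move=> kn; rewrite -[RHS]subn0 -(sum_range 0 kn) -sum1_card [LHS]big_mkcond.
by apply: eq_bigr => i _; rewrite inE; case: ifP.
Qed.

Lemma card_tail : #|[set i : 'I_n | k <= i]| = n - k.
Proof.
rewrite -(sum_range k (leqnn n)) -sum1_card [LHS]big_mkcond.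
by apply: eq_bigr => i _; rewrite inE ltn_ord andbT; case: ifP.
Qed.

Lemma sum_head_tail x : \sum_i x i = head x + tail x.
Proof.
rewrite (bigID (fun i : 'I_n => i < k)) /=; congr (_ + _).
by apply: eq_bigl => i; rewrite -leqNgt.
Qed.

Let flip_eq (a h l c : nat) : a + h = c -> (h + l == c) = (a == l).
Proof. lia. Qed.

Let flip_le (a h l c : nat) : a + h = c -> (h + l == c) && (l <= t) = (a == l) && (a < t.+1).
Proof. lia. Qed.

Let flip_ge (a h l c : nat) : a + l = t + c -> (h + l == t + c) && (l <= c) = (h == a) && (t <= h).
Proof. lia. Qed.

Lemma card_U_flip : k <= n ->
  #|[set x : X | \sum_i x i == k * t]| = #|[set x : X | head x == tail x]|.
Proof.
move=> kn; apply: (@card_flip (fun i => i < k)) => x; rewrite /= sum_head_tail.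
have := @sum_flip_in (fun i => i < k) (fun i => i < k) x (fun i h => h).
have := @sum_flip_out (fun i => i < k) (fun i => k <= i) x.
rewrite card_head // => -> => [|i]; last by rewrite -leqNgt.
exact: flip_eq.
Qed.

Lemma card_T_flip : k <= n ->
  #|[set x : X | (\sum_i x i == k * t) && (tail x <= t)]|
  = #|[set x : X | (head x == tail x) && (head x < t.+1)]|.
Proof.
move=> kn; apply: (@card_flip (fun i => i < k)) => x; rewrite /= sum_head_tail.
have := @sum_flip_in (fun i => i < k) (fun i => i < k) x (fun i h => h).
have := @sum_flip_out (fun i => i < k) (fun i => k <= i) x.
rewrite card_head // => -> => [|i]; last by rewrite -leqNgt.
exact: flip_le.
Qed.

(** Here the rank is n - k, so the tail is complemented, and its upper bound (n - k - 1) t becomes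
    the lower bound t. *)
Lemma card_Sp_flip : k < n ->
  #|[set x : X | (\sum_i x i == (n - k) * t) && (tail x <= (n - k).-1 * t)]|
  = #|[set x : X | (head x == tail x) && (t <= head x)]|.
Proof.
move=> kn; apply: (@card_flip (fun i => k <= i)) => x; rewrite /= sum_head_tail.
have := @sum_flip_in (fun i => k <= i) (fun i => k <= i) x (fun i h => h).
have := @sum_flip_out (fun i => k <= i) (fun i => i < k) x.
rewrite card_tail // => -> => [|i]; last by rewrite -ltnNge.
have -> : n - k = (n - k).-1.+1 by lia.
rewrite mulSn; exact: flip_ge.
Qed.

Lemma card_eq_head_tail b :
  #|[set x : X | (head x == tail x) && (head x < b)]| =
  \sum_(s < b) #|[set x : X | (head x == s) && (tail x == s)]|.
Proof.
rewrite -sum1_card big_mkcond /=.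
under [RHS]eq_bigr do rewrite -sum1_card big_mkcond /=.
rewrite [RHS]exchange_big /=; apply: eq_bigr => x _.
rewrite inE; case: ifP => [/andP[/eqP e lt]|ne].
  rewrite (bigD1 (Ordinal lt)) //= inE /= eqxx -e eqxx big1 // => s /eqP ne.
  by rewrite inE; case: eqP => // es; case: ne; apply: val_inj.
rewrite big1 // => s _; rewrite inE; case: ifP => // /andP[/eqP e1 /eqP e2].
by move: ne; rewrite e1 e2 eqxx ltn_ord.
Qed.

End EhrhartCounts.

(** * Generating functions of the lattice point counts *)

Section GeneratingFunctions.
Local Open Scope ring_scope.
Local Notation K := {poly rat}.

Lemma mono_prod (I : finType) (f g : I -> nat) :
  \prod_i mono (f i) (g i) = mono (\sum_i f i)%N (\sum_i g i)%N.
Proof.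
apply: (big_rec3 (fun a b c => a = mono b c)) => [|i a b c _ ->].
  by rewrite /mono !expr0 polyC1 mulr1.
by rewrite monoM.
Qed.

Lemma geo1E (R : comNzRingType) N : geo N (1 : R) = \sum_(v < N) 'X^v.
Proof. by rewrite /geo poly_def; apply: eq_bigr => v _; rewrite expr1n scale1r. Qed.

Lemma card_sum_eq n t a :
  #|[set x : {ffun 'I_n -> 'I_t.+1} | \sum_i x i == a]%N|%:R = (geo t.+1 (1 : rat) ^+ n)`_a.
Proof.
rewrite geo1E -[in RHS](card_ord n) -prodr_const bigA_distr_bigA coef_sum /=.
rewrite -sum1_card natr_sum big_mkcond /=; apply: eq_bigr => x _.
rewrite -(big_morph _ (@exprD _ 'X) (expr0 'X)) coefXn inE eq_sym.
by case: eqP.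
Qed.

(** x marks the head sum and z the tail sum; the cap t on the coordinates is invisible in degrees s
    <= t. *)
Lemma card_head_tail_eq k n t s : (0 < k < n)%N -> (s <= t)%N ->
  #|[set x : {ffun 'I_n -> 'I_t.+1} | (\sum_(i < n | i < k) x i == s)
       && (\sum_(i < n | k <= i) x i == s)]%N|%:R
  = 'C(k.-1 + s, s)%:R * 'C((n - k).-1 + s, s)%:R :> rat.
Proof.
move=> /andP[k0 kn] st.
pose F (i : 'I_n) (v : 'I_t.+1) := if (i < k)%N then mono 0 v else mono v 0.
have E : \prod_i \sum_v F i v = ((geo t.+1 (1 : rat)) ^+ k)%:P * geo t.+1 (1 : K) ^+ (n - k).
  rewrite (bigID (fun i : 'I_n => i < k)%N) /=; congr (_ * _).
    rewrite (eq_bigr (fun=> (geo t.+1 1)%:P)) => [|i ik].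
      rewrite prodr_const rmorphXn /=; congr (_ ^+ _).
      by rewrite -[RHS](card_head (ltnW kn)); apply: eq_card => i; rewrite inE.
    rewrite geo1E rmorph_sum /=; apply: eq_bigr => v _.
    by rewrite /F ik /mono expr0 mulr1.
  rewrite (eq_bigr (fun=> geo t.+1 1)) => [|i /negbTE ik].
    rewrite prodr_const; congr (_ ^+ _).
    by rewrite -[RHS]card_tail; apply: eq_card => i; rewrite inE leqNgt.
  rewrite geo1E; apply: eq_bigr => v _.
  by rewrite /F ik /mono expr0 polyC1 mul1r.
have := congr1 (bcoef s s) E; rewrite bigA_distr_bigA bcoef_sum /=.
rewrite {2}/bcoef coefCM.
have [k' ek] : exists k', k = k'.+1 by exists k.-1; lia.
have [m em] : exists m, (n - k = m.+1)%N by exists (n - k).-1; lia.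
rewrite [in X in _ = X -> _]em [in X in _ = X -> _]ek !coef_geoXS // !expr1n mulr1 -polyC_natr coefMC coef_geoXS //.
rewrite expr1n mulr1; have -> : k.-1 = k' by rewrite ek.
rewrite em /= => <-.
rewrite -sum1_card natr_sum big_mkcond /=; apply: eq_bigr => x _.
have -> : \prod_i F i (x i) = mono (\sum_(i < n | k <= i) x i)%N (\sum_(i < n | i < k) x i)%N.
  rewrite [in RHS]big_mkcond [X in mono _ X]big_mkcond /= -mono_prod.
  by apply: eq_bigr => i _; rewrite /F ltnNge; case: leqP.
by rewrite bcoef_mono inE andbC ![s == _]eq_sym; case: ifP.
Qed.

Lemma coef_1BXn_exp m d i : ((1 - 'X^(d.+1)) ^+ m : {poly rat})`_i =
  \sum_(j < m.+1) (-1) ^+ j * 'C(m, j)%:R * (i == j * d.+1)%N%:R.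
Proof.
rewrite exprBn coef_sum; apply: eq_bigr => j _.
rewrite expr1n mulr1 -exprM [(d.+1 * j)%N]mulnC coefMn.
have -> : (-1) ^+ j = ((-1) ^+ j)%:P :> {poly rat} by rewrite polyC_exp polyCN polyC1.
by rewrite coefCM coefXn mulrAC -[LHS]mulr_natr.
Qed.

(** Inclusion-exclusion over coordinates exceeding t, by expanding a power of (1 - z^(t+1))/(1 -
    z). *)
Lemma coef_geo_hypersimplex p q t :
  (geo t.+1 (1 : rat) ^+ (p + q).+2)`_(p.+1 * t) = \sum_(j < p.+1)
   (-1) ^+ j * ('C((p + q).+2, j) * 'C((p.+1 - j) * t + (p + q).+1 - j, (p + q).+1))%:R.
Proof.
set m := (p + q).+1; set M := (p.+1 * t).+1.
have h : eqtr M (geo t.+1 (1 : rat) ^+ m.+1) ((1 - 'X^(t.+1)) ^+ m.+1 * geo M (1 : rat) ^+ m.+1).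
  rewrite -exprMn; apply: eqtrX.
  have e : geo t.+1 (1 : rat) * (1 - 'X) = 1 - 'X^(t.+1).
    by rewrite geo1E mulrC -[RHS]opprB subrX1 -mulNr opprB.
  have := eqtrM (eqtr_refl M (geo t.+1 (1 : rat))) (eqtr_sym (eqtr_geo (N := M) (1 : rat))).
  by rewrite mulr1 polyC1 mul1r mulrA e.
rewrite h // coefM.
under eq_bigr => i _ do rewrite coef_1BXn_exp mulr_suml.
rewrite exchange_big /=.
have ejm (j : 'I_m.+2) : (j <= p)%N -> (j * t.+1 <= p.+1 * t)%N ->
   ((p.+1 - j) * t + m - j = m + (p.+1 * t - j * t.+1))%N.
  move=> jp hj; rewrite mulnBl mulnS in hj *; lia.
(* The expansion runs up to j = m + 1, but j > p contributes nothing since then j (t+1) > (p+1)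
   t. *)
pose f (j : nat) : rat := if (j <= p)%N then (-1) ^+ j * ('C(m.+1, j) * 'C((p.+1 - j) * t + m - j, m))%:R else 0.
transitivity (\sum_(j < m.+2) f j); last first.
  rewrite (big_ord_widen m.+2 (fun j => (-1) ^+ j * ('C(m.+1, j) * 'C((p.+1 - j) * t + m - j, m))%:R)); last by rewrite /m; lia.
  by rewrite [RHS]big_mkcond.
apply: eq_bigr => j _; rewrite /f.
have [hj|hj] := leqP (j * t.+1) (p.+1 * t).
  have hb : (j * t.+1 < (p.+1 * t).+1)%N by [].
  rewrite (bigD1 (Ordinal hb)) //= big1 => [|i /eqP ne]; last first.
    by case: eqP => [e|_]; [case: ne; apply: val_inj|rewrite mulr0 mul0r].
  rewrite eqxx mulr1 addr0 coef_geoXS; last by rewrite /M; lia.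
  have jp : (j <= p)%N by rewrite mulnS in hj; nia.
  rewrite jp ejm // expr1n mulr1 natrM mulrA; congr (_ * _%:R).
  by rewrite -[in RHS](@bin_sub (m + _) m) ?leq_addr // addKn.
rewrite big1 => [|i _]; last first.
  by case: eqP => [e|_]; [have := ltn_ord i; lia|rewrite mulr0 mul0r].
(* If j <= p but j (t+1) > (p+1) t, the right-hand term vanishes too: the upper index of its
   binomial is below m. *)
case: ifP => // jp; rewrite [X in (_ * X)%N]bin_small ?muln0 ?mulr0 //.
have h1 : (j * t <= p.+1 * t)%N by rewrite leq_mul2r (leqW jp) orbT.
have m0 : (0 < m)%N by [].
rewrite mulnS in hj; rewrite mulnBl; move: (p.+1 * t)%N (j * t)%N h1 hj => a b h1 hj; lia.
Qed.

End GeneratingFunctions.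

Theorem theorem1p6 (k n : nat) (hk : 2 <= k) (hkn : k + 2 <= n) :
  exists pT pS pU : {poly rat},
    [/\ is_ehrhart_poly (schubert_bases (T_set k n)) pT,
        is_ehrhart_poly (schubert_bases (Sp_set k n)) pS,
        is_ehrhart_poly (schubert_bases (U_set k n)) pU,
        (forall m : nat, m < size pS -> (0 < pS`_m)%R) &
        (forall m : nat, (pT`_m <= pS`_m)%R /\ (pS`_m <= pU`_m)%R)].
Proof.
have [p ek] : exists p, k = p.+1 by exists k.-1; lia.
have [q en] : exists q, n = (p + q).+2 by exists (n - k).-1; lia.
have kn : k < n by lia.
have p0 : 0 < p by lia.
have q0 : 0 < q by lia.
exists (min_poly p q), (unif_poly p q - min_poly_pred p q)%R, (unif_poly p q).
(* Used with b = t + 1 for T, and with b = t for the points that separate U from Sp. *)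
have hc t b : b <= t.+1 ->
    (#|[set x : {ffun 'I_n -> 'I_t.+1} | (\sum_(i < n | i < k) x i == \sum_(i < n | k <= i) x i)
      && (\sum_(i < n | i < k) x i < b)]%N|%:R =
    \sum_(s < b) 'C(s + p, p)%:R * 'C(s + q, q)%:R :> rat)%R.
  move=> bt; rewrite card_eq_head_tail natr_sum; apply: eq_bigr => s _.
  rewrite card_head_tail_eq; [|lia|by have := ltn_ord s; lia].
  have -> : (n - k).-1 = q by lia.
  have -> : k.-1 = p by lia.
  by rewrite -!(@bin_sub (_ + s) s) ?leq_addl // !addnK ![_ + s]addnC.
have hU t : (unif_poly p q).[t%:R]%R =
    (#|[set x : {ffun 'I_n -> 'I_t.+1} | \sum_(i < n | i < k) x i == \sum_(i < n | k <= i) x i]%N|%:R)%R.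
  rewrite unif_polyE -coef_geo_hypersimplex -card_U_flip ?(ltnW kn) // card_sum_eq.
  by rewrite ek en.
have le_US m : ((min_poly p q)`_m <= (unif_poly p q - min_poly_pred p q)`_m)%R.
  by rewrite coefB lerBrDr min_poly_add_pred_le.
split.
- by move=> t; rewrite min_polyE ehrhart_count_T // card_T_flip ?(ltnW kn) // hc.
- move=> t; rewrite hornerD hornerN hU min_poly_predE -(hc t t) // ehrhart_count_Sp // card_Sp_flip //.
  (* [B] is partitioned according to whether the head sum is at least t. *)
  set A := [set x | _ & _]; set B := [set x | _]; set C := [set x | _ & _].
  apply/eqP; rewrite subr_eq -natrD eqr_nat; apply/eqP.
  rewrite -(cardsID C B); congr (_ + _); apply: eq_card => x; rewrite !inE.
    by case: eqP.
  by case: eqP => //= _; rewrite -ltnNge andbT.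
- by move=> t; rewrite hU ehrhart_count_U ?card_U_flip ?(ltnW kn).
(* Positivity is inherited from i(T,t); the size bound keeps m in the range where its coefficients
   are positive. *)
- move=> m mS; apply: lt_le_trans (le_US m); apply: min_poly_gt0.
  apply: leq_trans mS _; apply: leq_trans (size_polyD _ _) _.
  by rewrite size_polyN geq_max !size_poly.
- move=> m; split=> //; rewrite coefB lerBlDr lerDl; exact: min_poly_pred_ge0.
Qed.
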